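(* Let $(\mathcal{X},\mathcal{A},P)$ be a probability space, $f\in L_2(P)$ real-valued, and $h=(h_1,\ldots,h_m)^T$ control variates $h_j\in L_2(P)$ with $P(h_j)=0$. Fix a minimizer $\beta^\star(f)\in\arg\min_{\beta\in\mathbb{R}^m}P[(f-P(f)-\beta^Th)^2]$, let $\epsilon=f-P(f)-\beta^\star(f)^Th$, $S^\star=\operatorname{supp}(\beta^\star(f))$, assumed nonempty, $\ell^\star=|S^\star|$. Assume: (i) $\epsilon\in\mathcal{G}(\tau^2)$ for some $\tau>0$; (ii) $U_h:=\max_j\sup_x|h_j(x)|<\infty$; (iii) the $h_k$, $k\in S^\star$, are linearly independent in $L_2(P)$, so $G_{S^\star}=P(h_{S^\star}h_{S^\star}^T)$ is positive definite with smallest eigenvalue $\gamma^{\star\star}>0$; (iv) $P(h_jh_k)=0$ for all $j\notin S^\star$, $k\in S^\star$. Put $\xi^\star=\ell^\star U_h^2/\gamma^{\star\star}$ and $B^\star=\sup_{x\in\mathcal{X}}h_{S^\star}(x)^TG_{S^\star}^{-1}h_{S^\star}(x)$. Let $X_1,\ldots,X_n$ be i.i.d. $P$. Then for all $\delta\in(0,1)$, every integer $N\in\{1,\ldots,n\}$ with $N\ge75(\xi^\star)^2\log(20\ell^\star m/\delta)$, and every $\lambda$ with $$13U_h\sqrt{\log(20m/\delta)}\frac{\tau}{\sqrt N}\le\lambda\le\frac{\gamma^{\star\star}}{3\sqrt{\ell^\star}}\min_{k\in S^\star}|\beta_k^\star(f)|,$$ with probability at least $1-\delta$, $$|\hat\alpha_n^{\mathrm{lslasso}}(f)-P(f)|\le\sqrt{2\log(16/\delta)}\frac{\tau}{\sqrt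 n}+58\sqrt{B^\star\ell^\star\log(16\ell^\star/\delta)\log(8/\delta)}\,\frac{\tau}{n}.$$
   Context: A centered random variable $Y$ is in $\mathcal{G}(\tau^2)$ if $\log\mathbb{E}[e^{\lambda Y}]\le\lambda^2\tau^2/2$ for all real $\lambda$; for a function $\epsilon$ this means $\int e^{\lambda\epsilon}dP\le e^{\lambda^2\tau^2/2}$ for all $\lambda$. $h_S=(h_k)_{k\in S}$. For a sample size $k$, let $f^{(k)}=(f(X_i))_{i\le k}$, $H^{(k)}=(h_j(X_i))_{i\le k,j\le m}$, $f_c^{(k)}=f^{(k)}-\mathbb{1}_k(\mathbb{1}_k^Tf^{(k)})/k$, $H_c^{(k)}=H^{(k)}-\mathbb{1}_k(\mathbb{1}_k^TH^{(k)})/k$. The LASSO coefficient on the subsample $X_1,\ldots,X_N$ is $\hat\beta_N^{\mathrm{lasso}}(f)\in\arg\min_{\beta\in\mathbb{R}^m}\frac{1}{2N}\|f_c^{(N)}-H_c^{(N)}\beta\|_2^2+\lambda\|\beta\|_1$, with support $\hat S_N=\{j:\hat\beta^{\mathrm{lasso}}_{N,j}(f)\neq0\}$ of cardinality $\hat\ell$. The LSLASSO estimator is defined by $(\hat\alpha_n^{\mathrm{lslasso}}(f),\hat\beta_n^{\mathrm{lslasso}}(f))\in\arg\min_{(\alpha,\beta)\in\mathbb{R}\times\mathbb{R}^{\hat\ell}}\|f^{(n)}-\alpha\mathbb{1}_n-H^{(n)}_{\hat S_N}\beta\|_2^2$, where $H^{(n)}_{\hat S_N}=(h_j(X_i))_{i\le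 n,\,j\in\hat S_N}$ (OLS on the full sample using only the selected control variates). *)

(* Defs.v *)
From HB Require Import structures.
From mathcomp Require Import all_boot all_order all_algebra.
From mathcomp Require Import all_classical all_reals all_analysis.
Set Implicit Arguments. Unset Strict Implicit. Unset Printing Implicit Defensive.
Import Order.TTheory GRing.Theory Num.Theory.
Local Open Scope classical_set_scope.
Local Open Scope ring_scope.

Section Defs.
Context {R : realType} {d : measure_display} {T : measurableType d}.

Definition Pexp (P : probability T R) (g : T -> R) : R :=
  fine (\int[P]_x (g x)%:E).

Definition in_L2 (P : probability T R) (g : T -> R) : Prop :=
  measurable_fun setT g /\ P.-integrable setT (fun x => (g x ^+ 2)%:E).

Definition lincomb (m : nat) (beta : 'I_m -> R) (h : 'I_m -> T -> R) (x : T) : R :=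
  \sum_(j < m) beta j * h j x.

Definition cv_risk (P : probability T R) (m : nat) (f : T -> R)
    (h : 'I_m -> T -> R) (beta : 'I_m -> R) : \bar R :=
  \int[P]_x ((f x - Pexp P f - lincomb beta h x) ^+ 2)%:E.

Definition subgaussian (P : probability T R) (eps : T -> R) (tau : R) : Prop :=
  forall lam : R, (\int[P]_x (expR (lam * eps x))%:E <= (expR (lam ^+ 2 * tau ^+ 2 / 2))%:E)%E.

Definition supp (m : nat) (beta : 'I_m -> R) : {set 'I_m} := [set j | beta j != 0].

Definition Uh (m : nat) (h : 'I_m -> T -> R) : R :=
  \big[Num.max/0]_(j < m) sup [set `|h j x| | x in [set: T]].

Definition Gram (P : probability T R) (m : nat) (h : 'I_m -> T -> R) (S : {set 'I_m})
  : 'M[R]_#|S| :=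
  \matrix_(i < #|S|, k < #|S|) Pexp P (fun x => h (enum_val i) x * h (enum_val k) x).

Definition lambda_min (k : nat) (G : 'M[R]_k) : R := inf [set a | eigenvalue G a].

Definition hS (m : nat) (h : 'I_m -> T -> R) (S : {set 'I_m}) (x : T) : 'rV[R]_#|S| :=
  \row_(i < #|S|) h (enum_val i) x.

Definition Bstar (P : probability T R) (m : nat) (h : 'I_m -> T -> R) (S : {set 'I_m}) : R :=
  sup [set (hS h S x *m invmx (Gram P h S) *m (hS h S x)^T) 0 0 | x in [set: T]].

Definition lasso_obj (n N : nat) (m : nat) (f : T -> R) (h : 'I_m -> T -> R)
    (lam : R) (x : 'I_n -> T) (beta : 'I_m -> R) : R :=
  let fbar := (\sum_(i < n | (i < N)%N) f (x i)) / N%:R in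
  let hbar := fun j => (\sum_(i < n | (i < N)%N) h j (x i)) / N%:R in
  (2 * N%:R)^-1 * (\sum_(i < n | (i < N)%N)
      ((f (x i) - fbar) - \sum_(j < m) (h j (x i) - hbar j) * beta j) ^+ 2)
  + lam * \sum_(j < m) `|beta j|.

Definition is_lasso (n N m : nat) (f : T -> R) (h : 'I_m -> T -> R)
    (lam : R) (x : 'I_n -> T) (beta : 'I_m -> R) : Prop :=
  forall beta' : 'I_m -> R, lasso_obj N f h lam x beta <= lasso_obj N f h lam x beta'.

Definition ols_obj (n m : nat) (f : T -> R) (h : 'I_m -> T -> R) (x : 'I_n -> T)
    (alpha : R) (beta : 'I_m -> R) : R :=
  \sum_(i < n) (f (x i) - alpha - \sum_(j < m) h j (x i) * beta j) ^+ 2.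

(* (alpha, beta) is an LSLASSO estimator given the selected support S:
   beta is supported on S (i.e. beta restricted to S is a vector of R^S) and
   (alpha, beta) minimizes the OLS criterion over R x R^S. *)
Definition is_lslasso (n m : nat) (f : T -> R) (h : 'I_m -> T -> R) (x : 'I_n -> T)
    (S : {set 'I_m}) (alpha : R) (beta : 'I_m -> R) : Prop :=
  (forall j, j \notin S -> beta j = 0) /\
  forall (alpha' : R) (beta' : 'I_m -> R), (forall j, j \notin S -> beta' j = 0) ->
    ols_obj f h x alpha beta <= ols_obj f h x alpha' beta'.

End Defs.

Definition iid_sample {R : realType} {d : measure_display} {T : measurableType d}
    {dO : measure_display} {Omega : measurableType dO}
    (Q : probability Omega R) (P : probability T R) (n : nat) (X : 'I_n -> Omega -> T) : Prop :=
  (forall i, measurable_fun setT (X i)) /\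
  (forall i (A : set T), measurable A -> Q (X i @^-1` A) = P A) /\
  (forall A : 'I_n -> set T, (forall i, measurable (A i)) ->
     Q (\bigcap_(i in [set: 'I_n]) (X i @^-1` A i)) =
     (\big[*%E/1%E]_(i < n) Q (X i @^-1` A i))%E).

(* Main.v *)
(** On the subsample of size [N] the LASSO selects exactly [S = supp beta_star] (primal-dual
    witness), and on that event the LSLASSO is the ordinary least squares fit on the control
    variates of [S].  Writing [a] and [b] for the errors on the intercept and the coefficients, the
    normal equations give [a = mean eps - (mean h)^T b] and bound [b], in the norm of the Gram
    matrix [G], by the dual norm of [mean (eps h)]; so [a] is [mean eps] plus a product of two
    terms of order [1 / sqrt n].

    All deviation bounds come from one martingale-type estimate for sums of i.i.d. centered vectors
    in a Euclidean norm: since [cosh \o sqrt] is convex, [cosh |x + z|] is at most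
    [cosh |x| cosh M] plus a term linear in [z] whenever [|z| <= M], so that the expectation of
    [cosh |sum Z_i|] is bounded by a product over [i].  Unlike a union bound over coordinates this
    costs no factor [ln #|S|] in the bound on [mean (eps h)]. *)

Require Import Defs.
From HB Require Import structures.
From mathcomp Require Import all_boot all_order all_algebra.
From mathcomp Require Import all_classical all_reals all_analysis.
From mathcomp Require Import measurable_realfun.
From mathcomp Require Import ring lra.
Import Order.TTheory GRing.Theory Num.Theory.
Import numFieldNormedType.Exports.
Local Open Scope classical_set_scope.
Local Open Scope ring_scope.

Set Implicit Arguments.
Unset Strict Implicit.

(** * Convexity of cosh \o sqrt *)

(** The factor [sqrt (B * ell)], rather than [B], comes from treating the two factors of the product
    differently. In the norm of the inverse Gram matrix, the vector of control variates on [S] has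
    second moment exactly [ell] (a trace), so a Bernstein bound puts [ell] in the deviation of its
    mean and uses the supremum [B] only as a side condition. In [eps h] the noise may depend on [h]
    and is only sub-Gaussian, so the norm is dominated pointwise by [|eps| sqrt B]. Unbounded noise
    is the obstacle for the cosh estimate: the bound on the increment then varies with the
    observation, while the linear term integrates to zero only if its coefficient does not.
    Replacing [cosh b] by [expR b - b] frees that coefficient from [b]. The confidence levels are
    read off the logarithms in the statement: each event fails with probability at most a fixed
    fraction of [delta], adding up to [2 / 5 * delta] for support recovery and [3 / 5 * delta] for
    least squares. *)

Section Cosh.
Context {R : realType}.
Implicit Types x y : R.

Definition cosh (x : R) : R := (expR x + expR (- x)) / 2.

Lemma cosh0 : cosh 0 = 1.
Proof. by rewrite /cosh oppr0 expR0; field. Qed.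

Lemma cosh_gt0 x : 0 < cosh x.
Proof. by rewrite divr_gt0 // addr_gt0 ?expR_gt0. Qed.

Lemma cosh_ge0 x : 0 <= cosh x.
Proof. exact/ltW/cosh_gt0. Qed.

Lemma expR_le_cosh x : expR x <= 2 * cosh x.
Proof.
have -> : 2 * cosh x = expR x + expR (- x) by rewrite /cosh; field.
by rewrite lerDl expR_ge0.
Qed.

Lemma coshN x : cosh (- x) = cosh x.
Proof. by rewrite /cosh opprK addrC. Qed.

Lemma cosh_norm x : cosh `|x| = cosh x.
Proof. by case: (ger0P x) => // _; rewrite coshN. Qed.

(** Written as a half-sum of exponential coefficients, so that convergence is inherited from the
    exponential series; only the even terms survive. *)
Definition cosh_coeff (x : R) (i : nat) : R :=
  (exp_coeff x i + exp_coeff (- x) i) / 2.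

Lemma cosh_coeff_odd x i : odd i -> cosh_coeff x i = 0.
Proof.
by move=> oi; rewrite /cosh_coeff /exp_coeff /= exprNn -signr_odd oi expr1; ring.
Qed.

Lemma cosh_coeff_double x k : cosh_coeff x k.*2 = (x ^+ 2) ^+ k / k.*2`!%:R.
Proof.
rewrite /cosh_coeff /exp_coeff /= exprNn -signr_odd odd_double expr0 mul1r.
by rewrite -mul2n exprM; field; rewrite pnatr_eq0 -lt0n fact_gt0.
Qed.

Lemma cosh_coeff_ge0 x i : 0 <= cosh_coeff x i.
Proof.
have [oi|ei] := boolP (odd i); first by rewrite cosh_coeff_odd.
rewrite -(even_halfK ei) cosh_coeff_double.
by apply: mulr_ge0; rewrite ?invr_ge0 ?ler0n // exprn_ge0 // sqr_ge0.
Qed.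

Lemma cvg_cosh_series x : series (cosh_coeff x) @ \oo --> cosh x.
Proof.
have -> : series (cosh_coeff x) =
    fun n => (series (exp_coeff x) n + series (exp_coeff (- x)) n) / 2.
  by apply/funext => n; rewrite /series /= -big_split /= mulr_suml.
by apply: cvgMr_tmp; apply: cvgD; exact: is_cvg_series_exp_coeff.
Qed.

(** In the induction the convexity defect is [p q (s - t) (s ^ k - t ^ k)], whose last two factors
    have the same sign. *)
Lemma expr_chord (p q s t : R) (k : nat) : 0 <= p -> 0 <= q -> p + q = 1 ->
  0 <= s -> 0 <= t -> (p * s + q * t) ^+ k <= p * s ^+ k + q * t ^+ k.
Proof.
move=> p0 q0 pq s0 t0; elim: k => [|k ih]; first by rewrite !expr0 !mulr1 pq.
rewrite exprS; apply: le_trans (_ : (p * s + q * t) * (p * s ^+ k + q * t ^+ k) <= _).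
  by rewrite ler_wpM2l // addr_ge0 // mulr_ge0.
rewrite -subr_ge0.
have -> : p * s ^+ k.+1 + q * t ^+ k.+1 - (p * s + q * t) * (p * s ^+ k + q * t ^+ k)
   = p * q * ((s - t) * (s ^+ k - t ^+ k)).
  have -> : p = 1 - q by rewrite -pq addrK.
  by rewrite !exprS; ring.
apply: mulr_ge0; first exact: mulr_ge0.
have [st|ts] := leP s t.
  by rewrite mulr_le0 // subr_le0 // lerXn2r.
by apply: mulr_ge0; rewrite subr_ge0 ?lerXn2r ?nnegrE // ltW.
Qed.

(* [cosh \o sqrt] is convex on the half-line, its power series having nonnegative coefficients. *)
Lemma cosh_sqr_convex (p q r u v : R) : 0 <= p -> 0 <= q -> p + q = 1 ->
  r ^+ 2 = p * u ^+ 2 + q * v ^+ 2 -> cosh r <= p * cosh u + q * cosh v.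
Proof.
move=> p0 q0 pq ruv.
have h : (fun n => p * series (cosh_coeff u) n + q * series (cosh_coeff v) n)
    @ \oo --> p * cosh u + q * cosh v.
  by apply: cvgD; apply: cvgMl_tmp; exact: cvg_cosh_series.
refine (ler_cvg_to (@cvg_cosh_series r) h _).
apply: nearW => n; rewrite /series /= !mulr_sumr -big_split /=.
apply: ler_sum => i _; have [oi|ei] := boolP (odd i).
  by rewrite !cosh_coeff_odd // !mulr0 addr0.
rewrite -(even_halfK ei) !cosh_coeff_double ruv.
move: (u ^+ 2) (v ^+ 2) (sqr_ge0 u) (sqr_ge0 v) => s t s0 t0.
rewrite !mulrA -mulrDl; apply: ler_wpM2r; first by rewrite invr_ge0 ler0n.
exact: expr_chord.
Qed.

(** Termwise comparison by [2 ^ k * k! <= (2 k)!]. The partial sums of cosh are taken up to [2 n],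
    which pairs their even terms with the first [n] terms of the exponential series. *)
Lemma cosh_le_expR_sqr x : cosh x <= expR (x ^+ 2 / 2).
Proof.
refine (ler_cvg_to (@cvg_cosh_series x) (is_cvg_series_exp_coeff (x ^+ 2 / 2)) _).
apply: nearW => n.
apply: (@le_trans _ _ (series (cosh_coeff x) n.*2)).
  rewrite /series /= -addnn [leRHS](big_cat_nat (n := n)) ?leq_addr //=.
  by rewrite lerDl sumr_ge0 // => i _; exact: cosh_coeff_ge0.
elim: n => [|n ih]; first by rewrite /series /= !big_geq.
rewrite doubleS !seriesSr (@cosh_coeff_odd x n.*2.+1) /= ?odd_double // addr0.
apply: lerD => //; rewrite cosh_coeff_double /exp_coeff /= expr_div_n -mulrA.
apply: ler_wpM2l; first by rewrite exprn_ge0 // sqr_ge0.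
rewrite -invfM lef_pV2 ?posrE ?mulr_gt0 ?exprn_gt0 ?ltr0n ?fact_gt0 //.
rewrite -natrX -natrM ler_nat; elim: n {ih} => // n ih.
have -> : (2 ^ n.+1 * n.+1`! = n.*2.+2 * (2 ^ n * n`!))%N.
  by rewrite factS expnS -doubleS -mul2n !mulnA; congr muln; rewrite mulnAC.
rewrite doubleS factS leq_mul // factS.
by rewrite (leq_trans ih) // leq_pmull.
Qed.

(** Since [y >= 1 - expR (- y)], with [s = expR y + expR (- y)] it is enough that
    [s - 1 <= (s ^ 2 - 2) / 2], that is [s (s - 2) >= 0]. The right-hand side is a form that a
    sub-Gaussian hypothesis can integrate. *)
Lemma expR_subr_le_cosh y : 0 <= y -> expR y - y <= cosh (2 * y).
Proof.
move=> y0; have e0 := expR_gt0 y; have /ltW e0' := e0.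
have ey1 : expR (- y) * expR y = 1 by rewrite mulrC expRxMexpNx_1.
have := expR_ge1Dx (- y).
have -> : 2 * y = y + y by ring.
rewrite /cosh opprD !expRD.
move: ey1 (expR_gt0 (- y)); move: (expR y) (expR (- y)) e0 => u v u0 uv v0 h.
have : 0 <= (u + v) * (u + v - 2).
  apply: mulr_ge0; first by rewrite addr_ge0 ?ltW.
  have : 0 <= v * (u - 1) ^+ 2 by rewrite mulr_ge0 ?sqr_ge0 ?ltW.
  have -> : v * (u - 1) ^+ 2 = (v * u) * u - 2 * (v * u) + v by ring.
  by rewrite uv; lra.
have -> : (u + v) * (u + v - 2) = u * u + v * v + 2 * (v * u) - 2 * u - 2 * v by ring.
by rewrite uv; lra.
Qed.

(** From [expR y <= 1 / (1 - y)]: clearing the denominator leaves the excess [y ^ 2 (1 - 2 y)],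
    nonnegative on this interval. *)
Lemma expR_subr_le_sqr y : 0 <= y <= 2^-1 -> expR y - y <= 1 + 2 * y ^+ 2.
Proof.
move=> /andP[y0 y1]; have := expR_ge1Dx (- y).
have := expRxMexpNx_1 y; move: (expR_gt0 y) (expR (- y)); move: (expR y) => u u0 v uv h.
have : u * (1 - y) <= 1 by rewrite -[leRHS]uv ler_wpM2l // ltW.
have y3 : 0 <= y ^+ 2 * (1 - 2 * y) by apply: mulr_ge0; [exact: sqr_ge0|lra].
move=> h2; rewrite lerBlDr -(ler_pM2r (_ : 0 < 1 - y)); last by lra.
by apply: le_trans h2 _; nra.
Qed.

End Cosh.

Section Sinh.
Context {R : realType}.
Implicit Types x y : R.

Definition sinh (x : R) : R := (expR x - expR (- x)) / 2.

Lemma sinhE x : sinh x = expR x - cosh x.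
Proof. by rewrite /sinh /cosh; field. Qed.

Lemma sinh_le_cosh x : sinh x <= cosh x.
Proof.
rewrite /sinh /cosh ler_pM2r ?invr_gt0 // lerD2l.
by rewrite lerNl (le_trans _ (expR_ge0 _)) // oppr_le0 expR_ge0.
Qed.

Lemma le_sinh x : 0 <= x -> x <= sinh x.
Proof.
move=> x0.
have cs : (fun n => (series (exp_coeff x) n - series (exp_coeff (- x)) n) / 2)
    @ \oo --> sinh x.
  by apply: cvgMr_tmp; apply: cvgB; exact: is_cvg_series_exp_coeff.
refine (ler_cvg_to (cvg_cst x) cs _).
exists 2 => // n /= n2.
rewrite /series /= -sumrB (big_cat_nat (n := 2)) //= mulrDl.
rewrite !big_nat_recl // big_geq // /exp_coeff /= !expr0 !expr1 subrr add0r addr0.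
rewrite (_ : (x / 1`!%:R - - x / 1`!%:R) / 2 = x); last first.
  by rewrite (_ : 1`!%:R = 1 :> R) //; field.
rewrite lerDl mulr_ge0 ?invr_ge0 // sumr_ge0 // => i _.
rewrite -mulrBl mulr_ge0 ?invr_ge0 ?ler0n // exprNn -signr_odd.
rewrite subr_ge0; case: odd => /=; last by rewrite expr0 mul1r.
by rewrite expr1 mulN1r -subr_ge0 opprK addr_ge0 ?exprn_ge0.
Qed.

Lemma sinh_ge0 x : 0 <= x -> 0 <= sinh x.
Proof. by move=> x0; exact: (le_trans x0 (le_sinh x0)). Qed.

Lemma coshD x y : cosh (x + y) = cosh x * cosh y + sinh x * sinh y.
Proof. by rewrite /cosh /sinh opprD !expRD; field. Qed.

Lemma cosh_ge1 x : 1 <= cosh x.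
Proof.
have := expR_ge1Dx x; have := expR_ge1Dx (- x); rewrite /cosh; lra.
Qed.

(** Monotonicity is a case of the convexity above: [x ^ 2] is a mixture of [y ^ 2] and 0, and
    [cosh 0 = 1] is the minimum. *)
Lemma ler_cosh x y : `|x| <= `|y| -> cosh x <= cosh y.
Proof.
move=> xy; have [y0|y0] := eqVneq y 0.
  by move: xy; rewrite y0 normr0 normr_le0 => /eqP ->.
have x2y2 : x ^+ 2 <= y ^+ 2 by rewrite -(real_normK (num_real x)) -(real_normK (num_real y)) lerXn2r ?nnegrE.
have y20 : 0 < y ^+ 2 by rewrite exprn_even_gt0.
set p := x ^+ 2 / y ^+ 2.
have p0 : 0 <= p by rewrite divr_ge0 ?sqr_ge0.
have p1 : p <= 1 by rewrite ler_pdivrMr // mul1r.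
have := @cosh_sqr_convex R p (1 - p) x y 0 p0.
rewrite subr_ge0 => /(_ p1); rewrite subrKC => /(_ erefl).
rewrite expr0n /= mulr0 addr0 divfK ?gt_eqF // => /(_ erefl); rewrite cosh0 mulr1.
move=> h; apply: le_trans h _.
have := cosh_ge1 y => hy.
by rewrite -subr_ge0 (_ : _ - _ = (1 - p) * (cosh y - 1)); [rewrite mulr_ge0 // subr_ge0|ring].
Qed.

End Sinh.

(** * Semi-inner products, and the effect of one increment on the cosh of a norm *)

Section InnerProduct.
Context {R : realType} {p : nat}.
Implicit Types (A : 'M[R]_p) (u v x z : 'rV[R]_p).

Definition ip A u v : R := (u *m A *m v^T) 0 0.
Definition nrm A u : R := Num.sqrt (ip A u u).
Definition psd A : Prop := A^T = A /\ forall u, 0 <= ip A u u.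

Lemma ipDl A u v x : ip A (u + v) x = ip A u x + ip A v x.
Proof. by rewrite /ip !mulmxDl mxE. Qed.

Lemma ipZl A (a : R) u x : ip A (a *: u) x = a * ip A u x.
Proof. by rewrite /ip -!scalemxAl mxE. Qed.

Lemma ipC A u v : A^T = A -> ip A u v = ip A v u.
Proof. by move=> At; rewrite /ip -[RHS]trace_mx11 -mxtrace_tr trace_mx11 !trmx_mul trmxK At mulmxA. Qed.

Lemma ip_sum A u v : ip A u v = \sum_i \sum_j A i j * (u 0 i * v 0 j).
Proof.
rewrite /ip mxE exchange_big /=; apply: eq_bigr => j _.
by rewrite !mxE mulr_suml; apply: eq_bigr => i _; rewrite mulrAC mulrC.
Qed.

Lemma nrm_ge0 A u : 0 <= nrm A u. Proof. exact: sqrtr_ge0. Qed.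

Lemma nrm_sqr A u : psd A -> nrm A u ^+ 2 = ip A u u.
Proof. by move=> [_ h]; rewrite sqr_sqrtr. Qed.

Lemma ipDD A u v : A^T = A -> ip A (u + v) (u + v) = ip A u u + 2 * ip A u v + ip A v v.
Proof.
by move=> At; rewrite ipDl (ipC u) // (ipC v) // !ipDl (ipC v u) //; ring.
Qed.

Lemma nrmZ A (a : R) u : psd A -> nrm A (a *: u) = `|a| * nrm A u.
Proof.
move=> [At _]; rewrite /nrm ipZl ipC // ipZl mulrA -expr2 sqrtrM ?sqr_ge0 //.
by rewrite sqrtr_sqr.
Qed.

Lemma ip_CauchySchwarz A u v : psd A -> `|ip A u v| <= nrm A u * nrm A v.
Proof.
move=> Ap; have [At A0] := Ap.
rewrite -ler_sqr ?nnegrE ?mulr_ge0 ?nrm_ge0 // exprMn !nrm_sqr // real_normK ?num_real //.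
have key t : 0 <= ip A u u * t ^+ 2 + 2 * ip A u v * t + ip A v v.
  have := A0 (t *: u + v); rewrite ipDD // ipZl ipC // !ipZl; congr (_ <= _); ring.
have a0 := A0 u; have [u0|u0] := eqVneq (ip A u u) 0.
  suff -> : ip A u v = 0 by rewrite u0 expr0n mul0r.
  apply/eqP/negP => /negP uv0.
  (* The polynomial is affine here, and this value of [t] makes it equal to -1. *)
  have := key (- (ip A v v + 1) / (2 * ip A u v)); rewrite u0 mul0r add0r.
  rewrite mulrC divfK ?mulf_neq0 ?pnatr_eq0 //; lra.
have u1 : 0 < ip A u u by rewrite lt_def u0.
have := key (- ip A u v / ip A u u).
have -> : ip A u u * (- ip A u v / ip A u u) ^+ 2 + 2 * ip A u v * (- ip A u v / ip A u u)
   + ip A v v = (ip A u u * ip A v v - ip A u v ^+ 2) / ip A u u by field.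
by rewrite pmulr_lge0 ?invr_gt0 // subr_ge0.
Qed.

(* The right-hand side is affine in [z], so that it integrates exactly against a centered law.
   If [nrm A x * M = 0] the quotient is 0, and so is [ip A x z] by Cauchy-Schwarz. *)
Lemma cosh_nrmD A x z (M : R) : psd A -> nrm A z <= M ->
  cosh (nrm A (x + z)) <= cosh (nrm A x) * cosh M
    + ip A x z / (nrm A x * M) * (sinh (nrm A x) * sinh M).
Proof.
move=> Ap zM; have [At A0] := Ap; set a := nrm A x.
have M0 : 0 <= M := le_trans (nrm_ge0 _ _) zM.
have a0 : 0 <= a := nrm_ge0 _ _.
set c := ip A x z / (a * M).
have xz : `|ip A x z| <= a * M.
  by apply: le_trans (ip_CauchySchwarz _ _ Ap) _; rewrite ler_wpM2l.
have cE : c * (a * M) = ip A x z.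
  have [aM|aM] := eqVneq (a * M) 0; last by rewrite divfK.
  by move: xz; rewrite aM normr_le0 mulr0 => /eqP ->.
have c1 : `|c| <= 1.
  have [aM|aM] := eqVneq (a * M) 0; first by rewrite /c aM invr0 mulr0 normr0.
  have aM0 : 0 < a * M by rewrite lt_def aM mulr_ge0.
  by rewrite /c normrM normfV (gtr0_norm aM0) ler_pdivrMr // mul1r.
move: c1; rewrite ler_norml => /andP[c1 c2].
have r0 : 0 <= a ^+ 2 + M ^+ 2 + 2 * ip A x z.
  have : 0 <= (a - M) ^+ 2 by exact: sqr_ge0.
  by move: xz; rewrite ler_norml => /andP[]; nra.
set r := Num.sqrt (a ^+ 2 + M ^+ 2 + 2 * ip A x z).
apply: (@le_trans _ _ (cosh r)).
  apply: ler_cosh; rewrite !ger0_norm ?sqrtr_ge0 // ler_sqrt // ipDD //.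
  have : nrm A z ^+ 2 <= M ^+ 2 by rewrite lerXn2r ?nnegrE ?nrm_ge0.
  by rewrite -!nrm_sqr // -/a; lra.
(* [c] plays the role of the cosine between [x] and [z]: [a ^ 2 + M ^ 2 + 2 c a M] is the mixture of
   [(a + M) ^ 2] and [(a - M) ^ 2] with weights [(1 + c) / 2] and [(1 - c) / 2]. *)
have := @cosh_sqr_convex R ((1 + c) / 2) ((1 - c) / 2) r (a + M) (a - M).
move=> h; apply: le_trans (h _ _ _ _) _.
- by lra.
- by lra.
- by field.
- by rewrite sqr_sqrtr // -cE; field.
rewrite (coshD a (- M)) coshD coshN (_ : sinh (- M) = - sinh M); last first.
  by rewrite /sinh opprK; field.
by rewrite le_eqVlt; apply/orP; left; apply/eqP; field.
Qed.

(** Here the coefficient of the linear term does not involve [b], so [b] may depend on the random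
    [z]. Replacing [sinh b / b] by 1 costs at most [sinh (nrm A x) * (sinh b - b)], because the
    cosine is at most 1; as [sinh <= cosh], this turns [cosh b] into [cosh b + sinh b - b]. *)
Lemma cosh_nrmD_expR A x z (b : R) : psd A -> nrm A z <= b ->
  cosh (nrm A (x + z)) <= cosh (nrm A x) * (expR b - b)
    + ip A x z * (sinh (nrm A x) / nrm A x).
Proof.
move=> Ap zb; set a := nrm A x.
have b0 : 0 <= b := le_trans (nrm_ge0 _ _) zb.
have a0 : 0 <= a := nrm_ge0 _ _.
have xz : `|ip A x z| <= a * b.
  by apply: le_trans (ip_CauchySchwarz _ _ Ap) _; rewrite ler_wpM2l.
apply: le_trans (cosh_nrmD _ Ap zb) _; rewrite -/a.
have sb := le_sinh b0; have sa := sinh_ge0 a0; have sc := sinh_le_cosh a.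
have -> : expR b - b = cosh b + (sinh b - b) by rewrite sinhE; ring.
rewrite mulrDr -addrA lerD2l.
have [ab|ab] := eqVneq (a * b) 0.
  have -> : ip A x z = 0 by apply/eqP; move: xz; rewrite ab normr_le0.
  by rewrite !mul0r addr0 mulr_ge0 ?cosh_ge0 // subr_ge0.
have ab0 : 0 < a * b by rewrite lt_def ab mulr_ge0.
have [a1 b1] : a != 0 /\ b != 0 by move: ab; rewrite mulf_eq0 negb_or => /andP.
rewrite -lerBlDr.
have -> : ip A x z / (a * b) * (sinh a * sinh b) - ip A x z * (sinh a / a)
  = (ip A x z / (a * b)) * (sinh a * (sinh b - b)) by field; rewrite ?a1 ?b1.
apply: (@le_trans _ _ (1 * (sinh a * (sinh b - b)))).
  apply: ler_wpM2r; first by rewrite mulr_ge0 // subr_ge0.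
  by rewrite ler_pdivrMr // mul1r (le_trans (ler_norm _)).
by rewrite mul1r ler_wpM2r // subr_ge0.
Qed.

End InnerProduct.

Section IdentityForm.
Context {R : realType}.

Lemma nrm1_scalar (a : R) : nrm (1%:M : 'M[R]_1) a%:M = `|a|.
Proof. by rewrite /nrm /ip mulmx1 tr_scalar_mx -scalar_mxM mxE mulr1n -expr2 sqrtr_sqr. Qed.

Lemma ip1E (p : nat) (u : 'rV[R]_p) : ip 1%:M u u = \sum_j u 0 j ^+ 2.
Proof. by rewrite /ip mulmx1 mxE; apply: eq_bigr => j _; rewrite !mxE. Qed.

Lemma ip1_ge0 (p : nat) (u : 'rV[R]_p) : 0 <= ip 1%:M u u.
Proof. by rewrite ip1E sumr_ge0 // => j _; rewrite sqr_ge0. Qed.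

Lemma psd1 (p : nat) : psd (1%:M : 'M[R]_p).
Proof. by split; [exact: tr_scalar_mx|exact: ip1_ge0]. Qed.

End IdentityForm.

(** * Independence and sums of i.i.d. vectors *)

Section IidSampling.
Context {R : realType} {d : measure_display} {T : measurableType d}.
Context {P : probability T R} {dO : measure_display} {Omega : measurableType dO}.
Context {Q : probability Omega R} {n : nat} {X : 'I_n -> Omega -> T}.
Hypothesis iidX : iid_sample Q P X.

Let mX i : measurable_fun setT (X i). Proof. by case: iidX. Qed.

Let mXpre i B : measurable B -> measurable (X i @^-1` B).
Proof. by move=> mB; rewrite -[_ @^-1` _]setTI; exact: mX. Qed.

(* The [k]-th entry is a dummy, which makes the tuple independent of [X k]. *)
Definition others (k : 'I_n) (w : Omega) : n.-tuple T :=
  [tuple if i == k then point else X i w | i < n].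

Lemma measurable_others k : measurable_fun setT (others k).
Proof.
apply/measurable_fun_tnthP => i.
have -> : (@tnth n T)^~ i \o others k = fun w => if i == k then point else X i w.
  by apply/funext => w /=; rewrite tnth_mktuple.
by case: eqP => // _; exact: measurable_cst.
Qed.

(** A pi-system generating the product sigma-algebra: finite measures on tuples need only be
    compared on it. *)
Definition boxes : set (set (n.-tuple T)) :=
  [set C | exists2 A : 'I_n -> set T, (forall i, measurable (A i)) &
     C = [set w | forall i, A i (tnth w i)]].

Lemma boxes_measurable : boxes `<=` measurable.
Proof.
move=> _ [A mA ->].
have -> : [set w : n.-tuple T | forall i, A i (tnth w i)]
    = \bigcap_(i in [set: 'I_n]) ((@tnth n T)^~ i @^-1` A i).
  by apply/seteqP; split => w h i; [move=> _; exact: h|exact: (h i)].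
apply: fin_bigcap_measurable; first exact: finite_finset.
by move=> i _; rewrite -[_ @^-1` _]setTI; exact: measurable_tnth.
Qed.

Lemma measurable_boxes (C : set (n.-tuple T)) : measurable C -> <<s boxes >> C.
Proof.
apply: smallest_sub; first exact: smallest_sigma_algebra.
rewrite -bigcup_seq => D [i _ [B mB <-]]; apply: sub_sigma_algebra.
exists (fun j => if j == i then B else setT); first by move=> j; case: ifP.
rewrite setTI; apply/seteqP; split => [w Bw j|w /(_ i)]; last by rewrite eqxx.
by case: eqP => [->|].
Qed.

(** For fixed [B] both sides are finite measures in [C], hence determined by their values on boxes,
    where the product formula for the sample applies. *)
Lemma iid_indep k (C : set (n.-tuple T)) (B : set T) :
  measurable C -> measurable B ->
  (Q (others k @^-1` C `&` X k @^-1` B) = Q (others k @^-1` C) * P B)%E.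
Proof.
move=> mC mB; have [_ [XP XI]] := iidX.
have PB0 : 0 <= fine (P B) by rewrite fine_ge0.
pose W : {mfun Omega >-> n.-tuple T} :=
  HB.pack (others k) (isMeasurableFun.Build _ _ _ _ _ (measurable_others k)).
pose m0 : {measure set _ -> \bar R} := pushforward (mrestr Q (mXpre k mB)) W.
pose m1 := m0 (measurable_others k).
pose m2 : {measure set _ -> \bar R} := mscale (NngNum PB0) (distribution Q W).
have := @g_sigma_algebra_measure_unique _ R _ boxes boxes_measurable
  (fun=> setT) _ _ m1 m2 _ _ _ C (measurable_boxes mC).
have m1E D : m1 D = Q (others k @^-1` D `&` X k @^-1` B) by [].
have m2E D : m2 D = (Q (others k @^-1` D) * P B)%E.
  by rewrite /m2 /= /mscale /= fineK ?fin_num_measure // muleC.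
rewrite m1E m2E; apply.
- move=> _; exists (fun=> setT) => //; apply/seteqP; by split.
- by rewrite bigcup_const.
- move=> _ _ [A1 mA1 ->] [A2 mA2 ->]; exists (fun i => A1 i `&` A2 i).
    by move=> i; exact: measurableI.
  by apply/seteqP; split => w /= => [[h1 h2] i|h]; [split|split=> i; case: (h i)].
- move=> _ [A mA ->]; rewrite m1E m2E.
  (* The dummy entry either violates the constraint on coordinate [k], and both sides vanish, or
     satisfies it, and that constraint can be traded for one on [X k]. *)
  have [Ak|Ak] := pselect (A k point); last first.
    have -> : others k @^-1` [set w | forall i, A i (tnth w i)] = set0.
      apply/seteqP; split => w //= /(_ k).
      by rewrite tnth_mktuple eqxx.
    by rewrite set0I measure0 mul0e.
  have pre (D : set T) : others k @^-1` [set w | forall i, A i (tnth w i)] `&` X k @^-1` D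
      = \bigcap_(i in [set: 'I_n]) (X i @^-1` (if i == k then D else A i)).
    apply/seteqP; split => w /=.
      move=> [h Dk] i _; have := h i; rewrite tnth_mktuple /=.
      by case: eqP => [->|].
    move=> h; split; last by have := h k I; rewrite /= eqxx.
    by move=> i; have := h i I; rewrite /= tnth_mktuple; case: eqP => [->|].
  have QX (D : set T) : measurable D ->
     Q (\bigcap_(i in [set: 'I_n]) (X i @^-1` (if i == k then D else A i)))
     = (P D * \big[*%E/1%E]_(i < n | i != k) P (A i))%E.
    move=> mD; rewrite XI; last by move=> i; case: ifP.
    rewrite (bigD1 k) //= eqxx XP //; congr (_ * _)%E.
    by apply: eq_bigr => i /negPf ->; rewrite XP.
  rewrite pre QX // -[others k @^-1` _]setIT -[X in _ `&` X](preimage_setT (X k)) pre.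
  by rewrite QX // probability_setT mul1e muleC.
- move=> _; change (Q (others k @^-1` setT `&` X k @^-1` B) < +oo)%E; apply: (@le_lt_trans _ _ 1%E); last by rewrite ltry.
  by apply: probability_le1; apply: measurableI; [rewrite preimage_setT|exact: mXpre].
Qed.

(** Integrating out one observation with the others frozen: the law of the pair is a product measure
    by [iid_indep], so Tonelli applies. *)
Lemma iid_integral (k : 'I_n) (F : n.-tuple T * T -> \bar R) :
  measurable_fun [set: (n.-tuple T * T)%type] F -> (forall z, 0 <= F z)%E ->
  (\int[Q]_w F (others k w, X k w) = \int[Q]_w \int[P]_x F (others k w, x))%E.
Proof.
move=> mF F0.
pose W : {mfun Omega >-> n.-tuple T} :=
  HB.pack (others k) (isMeasurableFun.Build _ _ _ _ _ (measurable_others k)).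
have mWX : measurable_fun setT (fun w => (others k w, X k w)).
  by apply: measurable_fun_pair; [exact: measurable_others|exact: mX].
pose WX : {mfun Omega >-> (n.-tuple T * T)%type} :=
  HB.pack (fun w => (others k w, X k w)) (isMeasurableFun.Build _ _ _ _ _ mWX).
have prodE (D : set (n.-tuple T * T)) : measurable D ->
    (distribution Q W \x P)%E D = distribution Q WX D.
  apply: product_measure_unique => A B mA mB.
  rewrite /distribution /pushforward /= -iid_indep //.
transitivity (\int[distribution Q WX]_z F z)%E.
  by rewrite ge0_integral_distribution.
transitivity (\int[(distribution Q W \x P)%E]_z F z)%E.
  by apply: eq_measure_integral => D mD _; exact/esym/prodE.
rewrite fubini_tonelli1 // ge0_integral_distribution //.
  exact: measurable_fun_fubini_tonelli_F.
by move=> w; apply: integral_ge0.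
Qed.

End IidSampling.

Section Measurability.
Context {R : realType} {d : measure_display} {T : measurableType d} {p : nat}.

Lemma measurable_cosh : measurable_fun setT (@cosh R).
Proof.
apply: measurable_funM; last exact: measurable_cst.
apply: measurable_funD; first exact: measurable_expR.
by apply: measurableT_comp; [exact: measurable_expR|exact: oppr_measurable].
Qed.

Lemma measurable_nrm (A : 'M[R]_p) (u : T -> 'rV[R]_p) :
  (forall j, measurable_fun setT (fun w => u w 0 j)) ->
  measurable_fun setT (fun w => nrm A (u w)).
Proof.
move=> mu; have msqrt : measurable_fun setT (@Num.sqrt R).
  by apply: continuous_measurable_fun; exact: sqrt_continuous.
apply: (measurableT_comp msqrt).
under eq_fun do rewrite ip_sum.
apply: measurable_sum => i; apply: measurable_sum => j.
by apply: measurable_funM; [exact: measurable_cst|exact: measurable_funM].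
Qed.

End Measurability.

Section Whp.
Context {R : realType} {dO : measure_display} {Omega : measurableType dO}.
Variable Q : probability Omega R.

(* [G] itself need not be measurable: the LASSO minimizer is an arbitrary selection. *)
Definition fails_wp_le (p : R) (G : Omega -> Prop) : Prop :=
  exists2 B : set Omega, measurable B & (Q B <= p%:E)%E /\ forall w, ~ B w -> G w.

Lemma fails_wp_le_and (p q : R) (G H : Omega -> Prop) :
  fails_wp_le p G -> fails_wp_le q H -> fails_wp_le (p + q) (fun w => G w /\ H w).
Proof.
move=> [B mB [Bp BG]] [C mC [Cq CH]]; exists (B `|` C); first exact: measurableU.
split; last by move=> w /not_orP[wB wC]; split; [exact: BG|exact: CH].
by apply: le_trans (measureU2 _ mB mC) _; rewrite EFinD leeD.
Qed.

Lemma fails_wp_le_weaken (p q : R) (G H : Omega -> Prop) :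
  p <= q -> (forall w, G w -> H w) -> fails_wp_le p G -> fails_wp_le q H.
Proof.
move=> pq GH [B mB [Bp BG]]; exists B => //; split; last by move=> w /BG /GH.
by apply: le_trans Bp _; rewrite lee_fin.
Qed.

Lemma fails_wp_le_forall (I : finType) (p : R) (G : I -> Omega -> Prop) :
  (forall i, fails_wp_le p (G i)) ->
  fails_wp_le (#|I|%:R * p) (fun w => forall i, G i w).
Proof.
move=> h; suff [B mB [BE BG]] : fails_wp_le ((size (enum I))%:R * p)
    (fun w => forall i, i \in enum I -> G i w).
  by rewrite cardE; exists B => //; split => // w /BG wG i; apply: wG; rewrite mem_enum.
elim: (enum I) => [|i s ih]; first by exists set0 => //; rewrite measure0 mul0r.
rewrite /= -add1n natrD mulrDl mul1r.
apply: fails_wp_le_weaken (fails_wp_le_and (h i) ih) => // w [Gi Gs] j.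
by rewrite in_cons => /orP[/eqP ->|/Gs].
Qed.

End Whp.

(** * Exponential moments and Chernoff bounds for sums of vectors *)

Section Concentration.
Context {R : realType} {d : measure_display} {T : measurableType d}.
Context {P : probability T R} {dO : measure_display} {Omega : measurableType dO}.
Context {Q : probability Omega R} {n : nat} {X : 'I_n -> Omega -> T}.
Hypothesis iidX : iid_sample Q P X.
Context {p : nat} (A : 'M[R]_p).
Hypothesis psdA : psd A.

Let mX i : measurable_fun setT (X i). Proof. by case: iidX. Qed.

Definition sample_sum (V : nmodType) (k : nat) (Z : T -> V) (w : Omega) : V :=
  \sum_(i < n | (i < k)%N) Z (X i w).

Lemma measurable_sum_entry d' (U : measurableType d') (k : nat) (f : 'I_n -> U -> 'rV[R]_p) j :
  (forall i, measurable_fun setT (fun w => f i w 0 j)) ->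
  measurable_fun setT (fun w => (\sum_(i < n | (i < k)%N) f i w) 0 j).
Proof.
move=> mf.
have -> : (fun w => (\sum_(i < n | (i < k)%N) f i w) 0 j)
    = (fun w => \sum_(i < n) if (i < k)%N then f i w 0 j else 0).
  by apply/funext => w; rewrite summxE; exact: big_mkcond.
by apply: measurable_sum => i; case: (i < k)%N => //; exact: measurable_cst.
Qed.

Lemma mgf_sample_sum (Z : T -> 'rV[R]_p) (K : R) (k : nat) :
  (forall j, measurable_fun setT (fun t => Z t 0 j)) -> 0 <= K ->
  (forall x, (\int[P]_t (cosh (nrm A (x + Z t)))%:E <= (cosh (nrm A x) * K)%:E)%E) ->
  (k <= n)%N ->
  (\int[Q]_w (cosh (nrm A (sample_sum k Z w)))%:E <= (K ^+ k)%:E)%E.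
Proof.
move=> mZ K0 step; elim: k => [|k ih] kn.
  under eq_integral => w _.
    rewrite /sample_sum big_pred0 // /nrm /ip mul0mx mul0mx mxE sqrtr0 cosh0.
    over.
  rewrite integral_cst //. by rewrite [X in (1 * X)%E](probability_setT Q) mule1 expr0.
pose i0 : 'I_n := Ordinal kn.
pose Y (t : n.-tuple T) : 'rV[R]_p := \sum_(i < n | (i < k)%N) Z (tnth t i).
(* The dummy sits at index [k], which a sum over [i < k] never reads. *)
have YE w : Y (others (X := X) i0 w) = sample_sum k Z w.
  apply: eq_bigr => i ik; rewrite tnth_mktuple; case: eqP => // ii0.
  by move: ik; rewrite ii0 ltnn.
have sumE w : sample_sum k.+1 Z w = Y (others (X := X) i0 w) + Z (X i0 w).
  rewrite YE /sample_sum (bigD1 i0) //= addrC; congr (_ + _).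
  apply: eq_bigl => i; rewrite ltnS leq_eqVlt andb_orl.
  have -> : (val i == k) && (i != i0) = false by rewrite andbN.
  by rewrite /= andb_idr // => ik; apply/eqP => ii0; move: ik; rewrite ii0 ltnn.
pose F (z : n.-tuple T * T) : \bar R := (cosh (nrm A (Y z.1 + Z z.2)))%:E.
have mY j : measurable_fun setT (fun t => Y t 0 j).
  apply: measurable_sum_entry => i.
  by apply: (measurableT_comp (mZ j)); exact: measurable_tnth.
have mF : measurable_fun setT F.
  apply/measurable_EFinP; apply: (measurableT_comp measurable_cosh).
  apply: measurable_nrm => j; under eq_fun do rewrite mxE.
  apply: measurable_funD; first exact: (measurableT_comp (mY j) measurable_fst).
  exact: (measurableT_comp (mZ j) measurable_snd).
have F0 z : (0 <= F z)%E by rewrite lee_fin cosh_ge0.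
under eq_integral do rewrite sumE.
have := iid_integral iidX i0 mF F0; rewrite /F /= => ->.
apply: (@le_trans _ _ (\int[Q]_w (K%:E * (cosh (nrm A (sample_sum k Z w)))%:E))%E).
  apply: ge0_le_integral => //.
  - by move=> w _; apply: integral_ge0 => x _; rewrite lee_fin cosh_ge0.
  - apply: (measurableT_comp (measurable_fun_fubini_tonelli_F (m2 := P) F mF F0)).
    exact: (measurable_others iidX).
  - apply/measurable_EFinP; apply: measurable_funM; first exact: measurable_cst.
    apply: (measurableT_comp measurable_cosh); apply: measurable_nrm => j.
    by apply: measurable_sum_entry => i; exact: (measurableT_comp (mZ j)).
  - by move=> w _; rewrite -EFinM mulrC YE; exact: step.
rewrite ge0_integralZl //; last first.
- by move=> w _; rewrite lee_fin cosh_ge0.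
- apply/measurable_EFinP; apply: (measurableT_comp measurable_cosh).
  apply: measurable_nrm => j.
  by apply: measurable_sum_entry => i; exact: (measurableT_comp (mZ j)).
by rewrite exprS EFinM lee_wpmul2l // ih // ltnW.
Qed.

(** Markov's inequality for [2 * cosh (lam * norm)], which dominates the exponential; hence the
    factor 2 in every tail bound below. *)
Lemma tail_sample_sum (Z : T -> 'rV[R]_p) (lam K t : R) (k : nat) :
  (forall j, measurable_fun setT (fun x => Z x 0 j)) -> 0 <= lam -> 0 <= K ->
  (forall x, (\int[P]_t (cosh (nrm A (x + lam *: Z t)))%:E
      <= (cosh (nrm A x) * K)%:E)%E) ->
  (k <= n)%N ->
  fails_wp_le Q (2 * expR (- (lam * t)) * K ^+ k)
    (fun w => nrm A (sample_sum k Z w) <= t).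
Proof.
move=> mZ lam0 K0 step kn.
have mS : measurable_fun setT (fun w => nrm A (sample_sum k Z w)).
  apply: measurable_nrm => j.
  by apply: measurable_sum_entry => i; exact: (measurableT_comp (mZ j)).
pose C w := cosh (lam * nrm A (sample_sum k Z w)).
have mC : measurable_fun setT (fun w => (2 * C w)%:E).
  apply/measurable_EFinP; apply: measurable_funM; first exact: measurable_cst.
  by apply: (measurableT_comp measurable_cosh); apply: measurable_funM.
have C0 w : (0 <= (2 * C w)%:E)%E by rewrite lee_fin mulr_ge0 ?cosh_ge0.
have intC : (\int[Q]_w (2 * C w)%:E <= (2 * K ^+ k)%:E)%E.
  under eq_integral do rewrite EFinM.
  rewrite ge0_integralZl //; last 2 first.
  - apply/measurable_EFinP; apply: (measurableT_comp measurable_cosh).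
    exact: measurable_funM.
  - by move=> w _; rewrite lee_fin cosh_ge0.
  rewrite EFinM lee_wpmul2l // /C.
  have := @mgf_sample_sum (fun x => lam *: Z x) K k _ K0 step kn.
  move=> h; apply: le_trans (h _).
    apply: ge0_le_integral => //.
    + by move=> w _; rewrite lee_fin cosh_ge0.
    + apply/measurable_EFinP; apply: (measurableT_comp measurable_cosh).
      exact: measurable_funM.
    + apply/measurable_EFinP; apply: (measurableT_comp measurable_cosh).
      apply: measurable_nrm => j; apply: measurable_sum_entry => i.
      under eq_fun do rewrite mxE; apply: measurable_funM => //.
      exact: (measurableT_comp (mZ j)).
    + by move=> w _; rewrite /sample_sum -scaler_sumr nrmZ // ger0_norm.
  move=> j; under eq_fun do rewrite mxE; exact: measurable_funM.
have mB0 : measurable [set w | t < nrm A (sample_sum k Z w)].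
  rewrite [X in measurable X](_ : _ =
    [set: Omega] `&` (fun w => nrm A (sample_sum k Z w)) @^-1` `]t, +oo[%classic).
    exact: mS.
  by rewrite setTI; apply/seteqP; split => w /=; rewrite in_itv /= andbT.
exists [set w | t < nrm A (sample_sum k Z w)].
  exact: mB0.
split; last by move=> w /negP; rewrite -leNgt.
set B := [set w | _].
have mB : measurable B := mB0.
have : ((expR (lam * t))%:E * Q B <= (2 * K ^+ k)%:E)%E.
  rewrite -integral_cst //.
  apply: le_trans intC; apply: (@le_trans _ _ (\int[Q]_(w in B) (2 * C w)%:E)%E).
    apply: ge0_le_integral => //.
    - by move=> w _; rewrite lee_fin expR_ge0.
    - exact: measurable_funTS.
    - move=> w Bw; rewrite lee_fin; apply: le_trans (expR_le_cosh _).
      by rewrite ler_expR ler_wpM2l // ltW.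
  by apply: ge0_subset_integral => //; exact: measurableT.
rewrite -(@fineK _ (Q B)) ?fin_num_measure // -EFinM !lee_fin expRN => h.
by rewrite mulrAC ler_pdivlMr ?expR_gt0 // mulrC.
Qed.

End Concentration.

(** * Moment bounds for one observation *)

Section Expectation.
Context {R : realType} {d : measure_display} {T : measurableType d}.
Variable P : probability T R.
Implicit Types f g : T -> R.

Definition summable_rv (g : T -> R) : Prop := P.-integrable setT (EFin \o g).

Lemma summable_measurable g : summable_rv g -> measurable_fun setT g.
Proof. by move=> /measurable_int /measurable_EFinP. Qed.

Lemma summableD f g : summable_rv f -> summable_rv g ->
  summable_rv (fun x => f x + g x).
Proof. by move=> hf hg; have := integrableD measurableT hf hg. Qed.

Lemma summableZ (a : R) f : summable_rv f -> summable_rv (fun x => a * f x).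
Proof. by move=> hf; have := integrableZl measurableT a hf. Qed.

Lemma summable_cst (a : R) : summable_rv (fun=> a).
Proof. exact: finite_measure_integrable_cst. Qed.

Lemma summable_bounded f (M : R) : measurable_fun setT f ->
  (forall x, `|f x| <= M) -> summable_rv f.
Proof.
move=> mf fM; apply: (le_integrable measurableT _ _ (summable_cst M)).
  exact/measurable_EFinP.
move=> x _ /=; rewrite lee_fin; exact: le_trans (fM x) (ler_norm _).
Qed.

Lemma summable_dom f g : measurable_fun setT f -> summable_rv g ->
  (forall x, `|f x| <= g x) -> summable_rv f.
Proof.
move=> mf hg fg; apply: (le_integrable measurableT _ _ hg); first exact/measurable_EFinP.
move=> x _ /=; rewrite lee_fin; exact: le_trans (fg x) (ler_norm _).
Qed.

Lemma summable_sum (I : Type) (s : seq I) (p : pred I) (f : I -> T -> R) :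
  (forall i, p i -> summable_rv (f i)) -> summable_rv (fun x => \sum_(i <- s | p i) f i x).
Proof.
move=> hf; have := @integrable_sum _ _ _ P _ measurableT I s p (fun i => EFin \o f i) hf.
by apply: eq_integrable => // x _; rewrite /= sumEFin.
Qed.

Lemma summable_ge0 f (K : R) : measurable_fun setT f -> (forall x, 0 <= f x) ->
  (\int[P]_x (f x)%:E <= K%:E)%E -> summable_rv f.
Proof.
move=> mf f0 fK; apply/integrableP; split; first exact/measurable_EFinP.
under eq_integral do rewrite /= ger0_norm //.
by apply: le_lt_trans fK _; rewrite ltry.
Qed.

Lemma PexpE f : summable_rv f -> (\int[P]_x (f x)%:E = (Pexp P f)%:E)%E.
Proof. by move=> hf; rewrite /Pexp fineK //; exact: integrable_fin_num. Qed.

Lemma PexpD f g : summable_rv f -> summable_rv g ->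
  Pexp P (fun x => f x + g x) = Pexp P f + Pexp P g.
Proof. by move=> hf hg; exact: RintegralD. Qed.

Lemma PexpZ (a : R) f : summable_rv f -> Pexp P (fun x => a * f x) = a * Pexp P f.
Proof. by move=> hf; exact: RintegralZl. Qed.

Lemma Pexp_cst (a : R) : Pexp P (fun=> a) = a.
Proof.
by rewrite /Pexp integral_cst // [X in (_ * X)%E](probability_setT P) mule1.
Qed.

Lemma Pexp_sum (I : Type) (s : seq I) (p : pred I) (f : I -> T -> R) :
  (forall i, summable_rv (f i)) ->
  Pexp P (fun x => \sum_(i <- s | p i) f i x) = \sum_(i <- s | p i) Pexp P (f i).
Proof.
move=> hf; rewrite /Pexp; under eq_integral do rewrite -sumEFin.
rewrite (integral_sum measurableT hf) -sum_fine // => i _.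
by apply: integrable_fin_num; [exact: measurableT|exact: hf].
Qed.

Lemma Pexp_le f g : summable_rv f -> summable_rv g -> (forall x, f x <= g x) ->
  Pexp P f <= Pexp P g.
Proof.
move=> hf hg fg; rewrite -lee_fin -!PexpE //.
by apply: le_integral => // x _; rewrite lee_fin.
Qed.

Lemma eq_Pexp f g : f =1 g -> Pexp P f = Pexp P g.
Proof. by move=> /funext ->. Qed.

End Expectation.

(** * One-step moment bounds for bounded, small-variance and sub-Gaussian increments *)

Section MgfSteps.
Context {R : realType} {d : measure_display} {T : measurableType d}.
Variable P : probability T R.
Context {p : nat} (A : 'M[R]_p).
Hypothesis psdA : psd A.

Definition centered (Z : T -> 'rV[R]_p) : Prop :=
  forall j, summable_rv P (fun t => Z t 0 j) /\ Pexp P (fun t => Z t 0 j) = 0.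

Lemma centeredZ (a : R) Z : centered Z -> centered (fun t => a *: Z t).
Proof.
move=> cZ j; have [sZ eZ] := cZ j.
have -> : (fun t => (a *: Z t) 0 j) = (fun t => a * Z t 0 j).
  by apply/funext => t; rewrite mxE.
by split; [exact: summableZ|rewrite PexpZ // eZ mulr0].
Qed.

Lemma centered_measurable Z : centered Z ->
  forall j, measurable_fun setT (fun t => Z t 0 j).
Proof. by move=> cZ j; case: (cZ j) => /summable_measurable. Qed.

Lemma ip_centered Z x : centered Z ->
  summable_rv P (fun t => ip A x (Z t)) /\ Pexp P (fun t => ip A x (Z t)) = 0.
Proof.
move=> cZ; have -> : (fun t => ip A x (Z t)) =
    fun t => \sum_j (x *m A) 0 j * Z t 0 j.
  by apply/funext => t; rewrite /ip mxE; apply: eq_bigr => j _; rewrite !mxE.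
have sZ j : summable_rv P (fun t => (x *m A) 0 j * Z t 0 j).
  by apply: summableZ; case: (cZ j).
split; first exact: summable_sum.
by rewrite Pexp_sum // big1 // => j _; rewrite PexpZ; [case: (cZ j) => _ ->; rewrite mulr0|case: (cZ j)].
Qed.

(** Common core of the one-step bounds. The factor [k t] may vary with the observation and only its
    mean counts, whereas [c] has to be constant for centering to remove the linear term. *)
Lemma mgf_step_affine Z (k : T -> R) (K : R) x (c : R) : centered Z ->
  summable_rv P k -> Pexp P k <= K ->
  (forall t, cosh (nrm A (x + Z t)) <= cosh (nrm A x) * k t + ip A x (Z t) * c) ->
  (\int[P]_t (cosh (nrm A (x + Z t)))%:E <= (cosh (nrm A x) * K)%:E)%E.
Proof.
move=> cZ sk kK step; have [si ei] := ip_centered x cZ.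
have s1 := summableZ (cosh (nrm A x)) sk; have s2 := summableZ c si.
apply: (@le_trans _ _ (\int[P]_t (cosh (nrm A x) * k t + c * ip A x (Z t))%:E)%E).
  apply: ge0_le_integral => //.
  - by move=> t _; rewrite lee_fin cosh_ge0.
  - apply/measurable_EFinP; apply: (measurableT_comp measurable_cosh).
    apply: measurable_nrm => j; under eq_fun do rewrite mxE.
    by apply: measurable_funD; [exact: measurable_cst|exact: centered_measurable].
  - by apply/measurable_EFinP; exact: (summable_measurable (summableD s1 s2)).
  - by move=> t _; rewrite lee_fin (mulrC c).
rewrite PexpE; last exact: summableD.
by rewrite PexpD // !PexpZ // ei mulr0 addr0 lee_fin ler_wpM2l // cosh_ge0.
Qed.

Lemma mgf_step_bounded Z (M : R) x : centered Z -> (forall t, nrm A (Z t) <= M) ->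
  (\int[P]_t (cosh (nrm A (x + Z t)))%:E <= (cosh (nrm A x) * cosh M)%:E)%E.
Proof.
move=> cZ ZM.
apply: (@mgf_step_affine Z (fun=> cosh M) _ x
  (sinh (nrm A x) * sinh M / (nrm A x * M))) => //.
- exact: summable_cst.
- by rewrite Pexp_cst.
- move=> t; have := cosh_nrmD x psdA (ZM t).
  by rewrite (mulrAC (ip A x (Z t))) -(mulrA (ip A x (Z t))).
Qed.

(** The increment is bounded by its own norm instead of by [M], so that the second moment [V]
    appears; [M] only keeps this norm in the range of [expR_subr_le_sqr]. *)
Lemma mgf_step_bernstein Z (M V : R) x : centered Z ->
  (forall t, nrm A (Z t) <= M) -> M <= 2^-1 ->
  summable_rv P (fun t => ip A (Z t) (Z t)) -> Pexp P (fun t => ip A (Z t) (Z t)) <= V ->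
  (\int[P]_t (cosh (nrm A (x + Z t)))%:E <= (cosh (nrm A x) * expR (2 * V))%:E)%E.
Proof.
move=> cZ ZM M2 si iV.
have s2 := summableZ 2 si.
apply: (@mgf_step_affine Z (fun t => 1 + 2 * ip A (Z t) (Z t)) _ x
  (sinh (nrm A x) / nrm A x)) => //.
- exact: (summableD (summable_cst P 1) s2).
- rewrite (PexpD (summable_cst P 1) s2) Pexp_cst PexpZ //.
  apply: le_trans (expR_ge1Dx _); rewrite lerD2l ler_pM2l //.
- move=> t; apply: le_trans (cosh_nrmD_expR x psdA (lexx _)) _.
  rewrite lerD2r ler_wpM2l ?cosh_ge0 // -nrm_sqr //.
  by apply: expR_subr_le_sqr; rewrite nrm_ge0 (le_trans (ZM t)).
Qed.

End MgfSteps.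

Section SubGaussian.
Context {R : realType} {d : measure_display} {T : measurableType d}.
Variable P : probability T R.
Variables (eps : T -> R) (tau : R).
Hypotheses (meps : measurable_fun setT eps) (sg : subgaussian P eps tau).

Let summable_expR a : summable_rv P (fun t => expR (a * eps t)).
Proof.
apply: (summable_ge0 _ _ (sg a)) => [|t]; last exact: expR_ge0.
by apply: (measurableT_comp (@measurable_expR R)); exact: measurable_funM.
Qed.

Let Pexp_expR_le a : Pexp P (fun t => expR (a * eps t)) <= expR (a ^+ 2 * tau ^+ 2 / 2).
Proof. by rewrite -lee_fin -PexpE; [exact: sg|exact: summable_expR]. Qed.

Lemma subgaussian_cosh (s : R) :
  summable_rv P (fun t => cosh (s * eps t)) /\
  Pexp P (fun t => cosh (s * eps t)) <= expR (s ^+ 2 * tau ^+ 2 / 2).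
Proof.
have se := summable_expR; have ee := Pexp_expR_le.
have -> : (fun t => cosh (s * eps t)) =
    (fun t => 2^-1 * (expR (s * eps t) + expR (- s * eps t))).
  by apply/funext => t; rewrite /cosh mulrC mulNr.
have sD := summableD (se s) (se (- s)).
split; first exact: summableZ.
rewrite PexpZ // PexpD //.
by have := ee s; have := ee (- s); rewrite sqrrN; lra.
Qed.

(** The increment is bounded by [|lam * M * eps t|], a random quantity. The factor 2 in
    [2 * M * tau] is the one lost in [expR_subr_le_cosh]. *)
Lemma mgf_step_subgaussian_mul (p : nat) (A : 'M[R]_p) (g : T -> 'rV[R]_p) (M lam : R) x :
  psd A -> 0 <= M -> (forall t, nrm A (g t) <= M) -> centered P (fun t => eps t *: g t) ->
  (\int[P]_t (cosh (nrm A (x + lam *: (eps t *: g t))))%:E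
     <= (cosh (nrm A x) * expR (lam ^+ 2 * (2 * M * tau) ^+ 2 / 2))%:E)%E.
Proof.
move=> psdA M0 gM cg.
have [s1 e1] := subgaussian_cosh (2 * (lam * M)).
apply: (@mgf_step_affine _ _ _ _ _ A _ _ _ x (sinh (nrm A x) / nrm A x)
  (centeredZ lam cg) s1).
  apply: le_trans e1 _; rewrite (_ : _ / 2 = lam ^+ 2 * (2 * M * tau) ^+ 2 / 2) //; ring.
move=> t; have b : nrm A (lam *: (eps t *: g t)) <= `|lam * M * eps t|.
  rewrite !nrmZ // !normrM (ger0_norm M0) -mulrA ler_wpM2l // mulrC.
  by rewrite ler_wpM2r.
apply: le_trans (cosh_nrmD_expR x psdA b) _.
rewrite lerD2r ler_wpM2l ?cosh_ge0 //.
apply: le_trans (expR_subr_le_cosh _) _ => //.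
by rewrite -[leRHS]cosh_norm -(mulrA 2) [X in _ <= cosh X]normrM normr_nat.
Qed.

(** In dimension one the cosh of a sum splits into two exponentials, each controlled directly by the
    hypothesis. No factor 2 is lost, as the leading term [tau * sqrt (2 ln (16 / delta) / n)]
    requires. *)
Lemma mgf_step_subgaussian (lam : R) (x : 'rV[R]_1) :
  (\int[P]_t (cosh (nrm 1%:M (x + lam *: (eps t)%:M)))%:E
     <= (cosh (nrm 1%:M x) * expR (lam ^+ 2 * tau ^+ 2 / 2))%:E)%E.
Proof.
rewrite (mx11_scalar x); move: (x 0 0) => {}x.
under eq_integral do rewrite scale_scalar_mx -raddfD nrm1_scalar cosh_norm.
rewrite nrm1_scalar cosh_norm.
have se := summable_expR; have ee := Pexp_expR_le.
have E : (fun t => cosh (x + lam * eps t)) =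
    (fun t => (expR x / 2) * expR (lam * eps t) + (expR (- x) / 2) * expR (- lam * eps t)).
  by apply/funext => t; rewrite /cosh opprD !expRD mulNr; field.
have s1 := summableZ (expR x / 2) (se lam).
have s2 := summableZ (expR (- x) / 2) (se (- lam)).
rewrite PexpE; last by rewrite E; exact: summableD.
rewrite E PexpD // !PexpZ // lee_fin /cosh.
have := ee lam; have := ee (- lam); rewrite sqrrN => h1 h2.
have := expR_ge0 x; have := expR_ge0 (- x); nra.
Qed.

End SubGaussian.

Section EmpiricalMean.
Context {R : realType} {T : Type} {n : nat}.
Implicit Types (x : 'I_n -> T) (g : T -> R) (k : nat).

Definition emp_mean k g x : R := (\sum_(i < n | (i < k)%N) g (x i)) / k%:R.

Lemma emp_meanD k f g x : emp_mean k (fun t => f t + g t) x = emp_mean k f x + emp_mean k g x.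
Proof. by rewrite /emp_mean big_split mulrDl. Qed.

Lemma emp_meanZ k (a : R) g x : emp_mean k (fun t => a * g t) x = a * emp_mean k g x.
Proof. by rewrite /emp_mean -mulr_sumr mulrA. Qed.

Lemma emp_mean_sum k (I : Type) (s : seq I) (p : pred I) (g : I -> T -> R) x :
  emp_mean k (fun t => \sum_(j <- s | p j) g j t) x = \sum_(j <- s | p j) emp_mean k (g j) x.
Proof. by rewrite /emp_mean exchange_big /= mulr_suml. Qed.

Lemma emp_mean_cst k (a : R) x : (0 < k <= n)%N -> emp_mean k (fun=> a) x = a.
Proof.
move=> /andP[k0 kn]; rewrite /emp_mean (big_ord_narrow kn) sumr_const card_ord.
by rewrite -[a *+ k]mulr_natr mulfK // pnatr_eq0 -lt0n.
Qed.

Lemma eq_emp_mean k f g x : f =1 g -> emp_mean k f x = emp_mean k g x.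
Proof. by move=> /funext ->. Qed.

Lemma emp_mean_ge0 k g x : (forall t, 0 <= g t) -> 0 <= emp_mean k g x.
Proof. by move=> g0; rewrite mulr_ge0 ?invr_ge0 ?ler0n // sumr_ge0. Qed.

End EmpiricalMean.

(** * Deviation inequalities for empirical means *)

Section Tails.
Context {R : realType} {d : measure_display} {T : measurableType d}.
Context {P : probability T R} {dO : measure_display} {Omega : measurableType dO}.
Context {Q : probability Omega R} {n : nat} {X : 'I_n -> Omega -> T}.
Hypothesis iidX : iid_sample Q P X.
Variables (k : nat) (L : R).
Hypotheses (kn : (0 < k <= n)%N) (L0 : 0 <= L).

Let k0 : 0 < k%:R :> R. Proof. by rewrite ltr0n; case/andP: kn. Qed.
Let kn' : (k <= n)%N. Proof. by case/andP: kn. Qed.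

Lemma emp_mean_rowE (p : nat) (Z : T -> 'rV[R]_p) w :
  \row_j emp_mean k (fun t => Z t 0 j) (X ^~ w) = k%:R^-1 *: sample_sum (X := X) k Z w.
Proof. by apply/rowP => j; rewrite !mxE summxE mulrC. Qed.

Lemma tail_subgaussian (p : nat) (A : 'M[R]_p) (Z : T -> 'rV[R]_p) (sigma : R) :
  psd A -> (forall j, measurable_fun setT (fun t => Z t 0 j)) -> 0 < sigma ->
  (forall lam x, (\int[P]_t (cosh (nrm A (x + lam *: Z t)))%:E
    <= (cosh (nrm A x) * expR (lam ^+ 2 * sigma ^+ 2 / 2))%:E)%E) ->
  fails_wp_le Q (2 * expR (- L))
    (fun w => nrm A (\row_j emp_mean k (fun t => Z t 0 j) (X ^~ w))
       <= sigma * Num.sqrt (2 * L / k%:R)).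
Proof.
move=> psdA mZ s0 step.
set r := Num.sqrt (2 * L / k%:R).
have r0 : 0 <= r by exact: sqrtr_ge0.
have r2 : r ^+ 2 = 2 * L / k%:R by rewrite sqr_sqrtr // divr_ge0 ?mulr_ge0 // ltW.
(* The Chernoff parameter [r / sigma] is the optimal one: the exponent becomes [- 2 L + L]. *)
have lam0 : 0 <= r / sigma by rewrite divr_ge0 // ltW.
have := @tail_sample_sum _ _ _ _ _ _ _ _ _ iidX p A psdA Z (r / sigma)
  (expR ((r / sigma) ^+ 2 * sigma ^+ 2 / 2)) (k%:R * (sigma * r)) k mZ lam0
  (expR_ge0 _) (step (r / sigma)) kn'.
apply: fails_wp_le_weaken.
  rewrite -expRM_natl -mulrA -expRD ler_pM2l // ler_expR.
  have -> : (r / sigma) ^+ 2 * sigma ^+ 2 = r ^+ 2 by field; rewrite gt_eqF.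
  rewrite (_ : r / sigma * (k%:R * (sigma * r)) = k%:R * r ^+ 2); last by field; rewrite gt_eqF.
  by rewrite r2 le_eqVlt; apply/orP; left; apply/eqP; field; rewrite gt_eqF.
move=> w; rewrite emp_mean_rowE nrmZ // normfV (gtr0_norm k0).
by move=> h; rewrite [leLHS]mulrC ler_pdivrMr // [leRHS]mulrC.
Qed.

Lemma tail_scalar (g : T -> R) (sigma : R) :
  measurable_fun setT g -> 0 < sigma ->
  (forall lam x, (\int[P]_t (cosh (nrm 1%:M (x + lam *: (g t)%:M)))%:E
    <= (cosh (nrm (1%:M : 'M[R]_1) x) * expR (lam ^+ 2 * sigma ^+ 2 / 2))%:E)%E) ->
  fails_wp_le Q (2 * expR (- L))
    (fun w => `|emp_mean k g (X ^~ w)| <= sigma * Num.sqrt (2 * L / k%:R)).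
Proof.
move=> mg s0 step.
have E j : (fun t => ((g t)%:M : 'rV[R]_1) 0 j) = g.
  by apply/funext => t; rewrite (ord1 j) mxE mulr1n.
have := tail_subgaussian (@psd1 R 1) (Z := fun t => (g t)%:M) _ s0 step.
move=> /(_ (fun j => eq_ind_r _ mg (E j))); apply: fails_wp_le_weaken => // w.
have -> : \row_j emp_mean k (fun t => ((g t)%:M : 'rV[R]_1) 0 j) (X ^~ w)
    = (emp_mean k g (X ^~ w))%:M.
  by apply/rowP => j; rewrite !mxE E (ord1 j) mulr1n.
by rewrite nrm1_scalar.
Qed.

Lemma centered_scalar (g : T -> R) : summable_rv P g -> Pexp P g = 0 ->
  centered P (fun t => (g t)%:M : 'rV[R]_1).
Proof.
move=> sg eg j.
have -> : (fun t => ((g t)%:M : 'rV[R]_1) 0 j) = g.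
  by apply/funext => t; rewrite (ord1 j) mxE mulr1n.
by split.
Qed.

Lemma tail_bounded (g : T -> R) (M : R) : summable_rv P g -> Pexp P g = 0 ->
  0 < M -> (forall t, `|g t| <= M) ->
  fails_wp_le Q (2 * expR (- L))
    (fun w => `|emp_mean k g (X ^~ w)| <= M * Num.sqrt (2 * L / k%:R)).
Proof.
move=> sg eg M0 gM; apply: tail_scalar => //; first exact: summable_measurable sg.
move=> lam x.
have b t : nrm 1%:M (lam *: ((g t)%:M : 'rV[R]_1)) <= `|lam| * M.
  by rewrite nrmZ ?nrm1_scalar ?ler_wpM2l //; exact: psd1.
apply: le_trans (mgf_step_bounded (@psd1 R 1) x (centeredZ lam (centered_scalar sg eg)) b) _.
rewrite lee_fin ler_wpM2l ?cosh_ge0 //.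
by apply: le_trans (cosh_le_expR_sqr _) _; rewrite exprMn real_normK ?num_real.
Qed.

Section Noise.
Variables (eps : T -> R) (tau : R).
Hypotheses (meps : measurable_fun setT eps) (sg : subgaussian P eps tau) (tau0 : 0 < tau).

Lemma tail_noise : fails_wp_le Q (2 * expR (- L))
  (fun w => `|emp_mean k eps (X ^~ w)| <= tau * Num.sqrt (2 * L / k%:R)).
Proof. by apply: tail_scalar => // lam x; exact: mgf_step_subgaussian. Qed.

Lemma tail_noise_mul (p : nat) (A : 'M[R]_p) (g : T -> 'rV[R]_p) (M : R) :
  psd A -> 0 < M -> (forall t, nrm A (g t) <= M) -> centered P (fun t => eps t *: g t) ->
  fails_wp_le Q (2 * expR (- L))
    (fun w => nrm A (\row_j emp_mean k (fun t => eps t * g t 0 j) (X ^~ w))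
       <= 2 * M * tau * Num.sqrt (2 * L / k%:R)).
Proof.
move=> psdA M0 gM cg.
have := tail_subgaussian psdA (centered_measurable cg) _
  (fun lam x => mgf_step_subgaussian_mul meps sg lam x psdA (ltW M0) gM cg).
have -> : 0 < 2 * M * tau by rewrite !mulr_gt0.
move=> /(_ isT); apply: fails_wp_le_weaken => // w.
congr (nrm A _ <= _); apply/rowP => j; rewrite !mxE; apply: eq_emp_mean => t.
by rewrite mxE.
Qed.

Lemma tail_noise_mul1 (g : T -> R) (M : R) : 0 < M -> (forall t, `|g t| <= M) ->
  summable_rv P (fun t => eps t * g t) -> Pexp P (fun t => eps t * g t) = 0 ->
  fails_wp_le Q (2 * expR (- L))
    (fun w => `|emp_mean k (fun t => eps t * g t) (X ^~ w)|
       <= 2 * M * tau * Num.sqrt (2 * L / k%:R)).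
Proof.
move=> M0 gM sum_eg eg0; apply: tail_scalar; first exact: summable_measurable sum_eg.
  by rewrite !mulr_gt0.
move=> lam x.
have gM' t : nrm 1%:M ((g t)%:M : 'rV[R]_1) <= M by rewrite nrm1_scalar.
have := @mgf_step_subgaussian_mul _ _ _ P eps tau meps sg 1 1%:M
  (fun t => (g t)%:M) M lam x (@psd1 R 1) (ltW M0) gM'.
have E : (fun t => eps t *: ((g t)%:M : 'rV[R]_1)) = fun t => (eps t * g t)%:M.
  by apply/funext => t; rewrite scale_scalar_mx.
rewrite E => /(_ (centered_scalar sum_eg eg0)).
by under eq_integral do rewrite scale_scalar_mx.
Qed.

End Noise.

Lemma tail_bernstein (p : nat) (A : 'M[R]_p) (Z : T -> 'rV[R]_p) (M V : R) :
  psd A -> centered P Z -> (forall t, nrm A (Z t) <= M) -> 0 < V ->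
  summable_rv P (fun t => ip A (Z t) (Z t)) -> Pexp P (fun t => ip A (Z t) (Z t)) <= V ->
  4 * M ^+ 2 * L <= k%:R * V ->
  fails_wp_le Q (2 * expR (- L))
    (fun w => nrm A (\row_j emp_mean k (fun t => Z t 0 j) (X ^~ w))
       <= 3 * Num.sqrt (V * L / k%:R)).
Proof.
move=> psdA cZ ZM V0 si iV ML.
(* With this choice the exponent is [- 3 L + 2 L], and the hypothesis on [M] says exactly that
   [lam * M <= 1 / 2]. *)
set lam := Num.sqrt (L / (k%:R * V)).
have kV0 : 0 < k%:R * V by rewrite mulr_gt0.
have lam0 : 0 <= lam by exact: sqrtr_ge0.
have lam2 : lam ^+ 2 = L / (k%:R * V) by rewrite sqr_sqrtr // divr_ge0 // ltW.
have M0 : 0 <= M by apply: le_trans (nrm_ge0 A (Z point)) (ZM _).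
have step x : (\int[P]_t (cosh (nrm A (x + lam *: Z t)))%:E
    <= (cosh (nrm A x) * expR (2 * (lam ^+ 2 * V)))%:E)%E.
  have E : (fun t => ip A (lam *: Z t) (lam *: Z t)) = fun t => lam ^+ 2 * ip A (Z t) (Z t).
    by apply/funext => t; rewrite -!nrm_sqr // nrmZ // exprMn real_normK ?num_real.
  apply: (@mgf_step_bernstein _ _ _ P p A psdA (fun t => lam *: Z t) (lam * M)).
  - exact: centeredZ.
  - by move=> t; rewrite nrmZ // ger0_norm // ler_wpM2l.
  - rewrite -(ler_pXn2r (n := 2)) ?nnegrE ?mulr_ge0 ?invr_ge0 // exprMn lam2.
    by rewrite mulrAC ler_pdivrMr //; nra.
  - by rewrite E; exact: summableZ.
  - by rewrite E PexpZ // ler_wpM2l // sqr_ge0.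
set t := k%:R * (3 * Num.sqrt (V * L / k%:R)).
have := @tail_sample_sum _ _ _ _ _ _ _ _ _ iidX p A psdA Z lam
  (expR (2 * (lam ^+ 2 * V))) t k (centered_measurable cZ) lam0 (expR_ge0 _) step kn'.
apply: fails_wp_le_weaken.
  rewrite -expRM_natl -mulrA -expRD ler_pM2l // ler_expR.
  have -> : lam * t = 3 * L.
    rewrite /t mulrCA (mulrCA lam) /lam -sqrtrM ?divr_ge0 ?(ltW kV0) //.
    have -> : L / (k%:R * V) * (V * L / k%:R) = (L / k%:R) ^+ 2.
      by field; rewrite !gt_eqF.
    by rewrite sqrtr_sqr ger0_norm ?divr_ge0 ?(ltW k0) //; field; rewrite gt_eqF.
  have -> : k%:R * (2 * (lam ^+ 2 * V)) = 2 * L.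
    by rewrite lam2; field; rewrite !gt_eqF.
  by lra.
move=> w; rewrite emp_mean_rowE nrmZ // normfV (gtr0_norm k0).
by move=> h; rewrite [leLHS]mulrC ler_pdivrMr // [leRHS]mulrC.
Qed.

End Tails.

(** * The smallest eigenvalue *)

Section LambdaMin.
Context {R : realType} {p : nat}.
Implicit Types (G : 'M[R]_p) (u v : 'rV[R]_p).

Lemma continuous_ip G : continuous (fun v => ip G v v).
Proof.
have -> : (fun v => ip G v v) = fun v => \sum_i \sum_j G i j * (v 0 i * v 0 j).
  by apply/funext => v; rewrite ip_sum.
apply: continuous_big => [|i _]; first exact: add_continuous.
apply: continuous_big => [|j _ v]; first exact: add_continuous.
apply: cvgMl_tmp; first exact: (nbhs_filter v).
exact: (cvgM (@coord_continuous _ _ _ 0 i v) (@coord_continuous _ _ _ 0 j v)).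
Qed.

Lemma ip1_gt0 u : u != 0 -> 0 < ip 1%:M u u.
Proof.
move=> u0; rewrite lt_def ip1E sumr_ge0 ?andbT; last by move=> j _; rewrite sqr_ge0.
apply: contra u0; rewrite psumr_eq0; last by move=> j _; rewrite sqr_ge0.
by move=> /allP h; apply/eqP/rowP => j; have := h j (mem_index_enum j);
  rewrite sqrf_eq0 mxE => /eqP.
Qed.

(* The minimum of the quadratic form on the unit sphere is an eigenvalue: with that minimum as
   [mu], the form of [G - mu] is positive semidefinite and vanishes at a minimizer [v], so
   Cauchy-Schwarz puts [v] in its kernel. *)
Lemma lambda_min_attained G : G^T = G -> (0 < p)%N ->
  exists v, [/\ v != 0, ip G v v = lambda_min G * ip 1%:M v v &
    forall u, lambda_min G * ip 1%:M u u <= ip G u u].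
Proof.
move=> Gt p0.
pose sphere : set 'rV[R]_p := [set v | ip 1%:M v v = 1].
have csphere : compact sphere.
  apply: bounded_closed_compact; last first.
    have /continuous_closedP h := @continuous_ip 1%:M.
    exact: (h [set 1] (@closed_eq R 1)).
  exists 1; split => // M M1 v /= v1.
  rewrite [leLHS]/Num.norm /= mx_normrE; apply/bigmax_leP; split; first exact/ltW/(lt_trans ltr01).
  move=> [i j] _ /=; apply: le_trans (ltW M1); rewrite (ord1 i).
  rewrite -(expr_le1 (n := 2)) // real_normK ?num_real // -v1 ip1E.
  by rewrite (bigD1 j) //= lerDl sumr_ge0 // => k _; exact: sqr_ge0.
have sphere0 : sphere !=set0.
  exists (delta_mx 0 (Ordinal p0)); rewrite /sphere /= ip1E (bigD1 (Ordinal p0)) //=.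
  rewrite mxE !eqxx expr1n big1 ?addr0 // => j /negPf j0.
  by rewrite mxE j0 andbF expr0n.
have [v vs vmin] := compact_EVT_min sphere0 csphere
  (continuous_subspaceT (@continuous_ip G)).
have v1 : ip 1%:M v v = 1 by move: vs; rewrite inE.
have v0 : v != 0 by apply/eqP => v0; move/eqP: v1; rewrite v0 /ip !mul0mx mxE eq_sym oner_eq0.
set mu := ip G v v.
have muP u : mu * ip 1%:M u u <= ip G u u.
  have [->|u0] := eqVneq u 0; first by rewrite /ip !mul0mx mxE mulr0.
  have n0 := ip1_gt0 u0.
  have nu : Num.sqrt (ip 1%:M u u) ^+ 2 = ip 1%:M u u by rewrite sqr_sqrtr // ltW.
  have ipZ (B : 'M[R]_p) (a : R) : B^T = B -> ip B (a *: u) (a *: u) = a ^+ 2 * ip B u u.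
    by move=> Bt; rewrite ipZl ipC // ipZl; ring.
  have us : ip 1%:M ((Num.sqrt (ip 1%:M u u))^-1 *: u) ((Num.sqrt (ip 1%:M u u))^-1 *: u) = 1.
    by rewrite ipZ ?trmx1 // exprVn nu mulVf // gt_eqF.
  have := vmin _ (mem_set us).
  rewrite ipZ // exprVn nu => h; rewrite -ler_pdivlMr // mulrC.
  exact: h.
have ipB u w : ip (G - mu%:M) u w = ip G u w - mu * ip 1%:M u w.
  rewrite /ip mulmxBr mulmxBl mul_mx_scalar mulmx1 -scalemxAl.
  by rewrite mxE [in X in _ + X]mxE [in X in _ - X]mxE.
have psdB : psd (G - mu%:M).
  split; first by rewrite linearB /= Gt tr_scalar_mx.
  by move=> u; rewrite ipB subr_ge0.
have vB : v *m (G - mu%:M) = 0.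
  apply/rowP => j; have := ip_CauchySchwarz v (delta_mx 0 j) psdB.
  have -> : nrm (G - mu%:M) v = 0 by rewrite /nrm ipB v1 mulr1 subrr sqrtr0.
  rewrite mul0r normr_le0 => /eqP.
  rewrite /ip mxE (bigD1 j) //= big1 => [|i /negPf ij].
    by rewrite [X in _ * X]mxE [X in _ * X]mxE !eqxx mulr1 addr0 => ->; rewrite mxE.
  by rewrite [X in _ * X]mxE [X in _ * X]mxE ij andbF mulr0.
have evmu : eigenvalue G mu.
  apply/eigenvalueP; exists v => //.
  by move/eqP: vB; rewrite mulmxBr mul_mx_scalar subr_eq0 => /eqP.
have lbmu : lbound [set a | eigenvalue G a] mu.
  move=> a /= /eigenvalueP[u uG u0]; have := muP u.
  rewrite {2}/ip uG -scalemxAl mxE -[X in _ <= a * X](_ : ip 1%:M u u = _) ?/ip ?mulmx1 //.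
  by rewrite ler_pM2r //; have := ip1_gt0 u0; rewrite /ip mulmx1.
have -> : lambda_min G = mu.
  apply/eqP; rewrite eq_le; apply/andP; split.
    by apply: ge_inf => //; exists mu.
  by apply: lb_le_inf => //; exists mu.
by exists v; split => //; rewrite v1 mulr1.
Qed.

End LambdaMin.

(** * Support recovery by the LASSO *)

Lemma sum_sqr_eq0 (R : realDomainType) (I : finType) (Pr : pred I) (F : I -> R) :
  \sum_(i | Pr i) F i ^+ 2 = 0 -> forall i, Pr i -> F i = 0.
Proof.
move=> F0 i Pi; apply/eqP; rewrite -sqrf_eq0; apply/eqP.
by apply: (psumr_eq0P _ F0) => // j _; exact: sqr_ge0.
Qed.

Lemma sqr_sum_norm_le (R : realFieldType) (m : nat) (S : {set 'I_m}) (c : 'I_m -> R) :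
  (forall j, j \notin S -> c j = 0) ->
  (\sum_j `|c j|) ^+ 2 <= #|S|%:R * \sum_j c j ^+ 2.
Proof.
move=> c0.
have E (F : R -> R) : F 0 = 0 -> \sum_j F (c j) = \sum_(j in S) F (c j).
  move=> F0; rewrite [RHS]big_mkcond /=; apply: eq_bigr => j _.
  by case: ifPn => // /c0 ->.
rewrite (E (fun x => `|x|)) ?normr0 // (E (fun x => x ^+ 2)) ?expr0n //.
have [->|S0] := eqVneq S finset.set0; first by rewrite !big_set0 expr0n mulr0.
have ell0 : 0 < #|S|%:R :> R by rewrite ltr0n card_gt0.
set ell := #|S|%:R in ell0 *; set a := \sum_(j in S) `|c j|.
(* Cauchy-Schwarz read off from the sum of squared deviations of the [|c j|] from their mean
   [a / ell]. *)
have : 0 <= \sum_(j in S) (`|c j| - a / ell) ^+ 2 by apply: sumr_ge0 => j _; exact: sqr_ge0.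
have -> : \sum_(j in S) (`|c j| - a / ell) ^+ 2 =
    \sum_(j in S) c j ^+ 2 - 2 * (a / ell) * a + ell * (a / ell) ^+ 2.
  rewrite -[ell * _](_ : \sum_(j in S) (a / ell) ^+ 2 = _); last first.
    by rewrite sumr_const -mulr_natl.
  rewrite mulr_sumr -sumrB -big_split /=; apply: eq_bigr => j _.
  by rewrite -(real_normK (num_real (c j))); ring.
have -> : \sum_(j in S) c j ^+ 2 - 2 * (a / ell) * a + ell * (a / ell) ^+ 2
    = (ell * \sum_(j in S) c j ^+ 2 - a ^+ 2) / ell by field; rewrite gt_eqF.
by rewrite pmulr_lge0 ?invr_gt0 // subr_ge0.
Qed.

(** By Cauchy-Schwarz on [S], an entrywise error [kap * gam / #|S|] changes the form by at most
    [kap * gam * |c| ^ 2], which coercivity bounds by a fraction [kap] of the form itself. It serves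
    for covariances on the subsample and for raw second moments on the full sample. *)
Lemma form_perturbation (R : realFieldType) (m : nat) (S : {set 'I_m})
    (Sig G : 'I_m -> 'I_m -> R) (gam kap : R) (c : 'I_m -> R) :
  0 < #|S|%:R :> R -> 0 < gam -> 0 <= kap ->
  (forall j, j \notin S -> c j = 0) ->
  gam * \sum_j c j ^+ 2 <= \sum_j \sum_k G j k * (c j * c k) ->
  (forall j k, k \in S -> `|Sig j k - G j k| <= kap * gam / #|S|%:R) ->
  (1 - kap) * \sum_j \sum_k G j k * (c j * c k) <= \sum_j \sum_k Sig j k * (c j * c k).
Proof.
move=> ell0 gam0 kap0 c0 coer close; have h2 := sqr_sum_norm_le c0.
have h3 : \sum_j \sum_k (G j k - Sig j k) * (c j * c k)
    <= kap * gam / #|S|%:R * (\sum_j `|c j|) ^+ 2.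
  rewrite expr2 mulr_suml mulr_sumr; apply: ler_sum => j _.
  rewrite mulr_sumr mulr_sumr; apply: ler_sum => k _.
  have [kS|/c0 ->] := boolP (k \in S); last by rewrite normr0 !mulr0.
  apply: le_trans (ler_norm _) _; rewrite !normrM ler_wpM2r ?mulr_ge0 //.
  by rewrite distrC; exact: close.
have h4 : kap * gam / #|S|%:R * (\sum_j `|c j|) ^+ 2 <= kap * (gam * \sum_j c j ^+ 2).
  rewrite -!mulrA ler_wpM2l // ler_pM2l // mulrC ler_pdivrMr // mulrC.
  by rewrite mulrC [leRHS]mulrC.
have h5 := ler_wpM2l kap0 coer.
have -> : \sum_j \sum_k Sig j k * (c j * c k) =
   \sum_j \sum_k G j k * (c j * c k) - \sum_j \sum_k (G j k - Sig j k) * (c j * c k).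
  by rewrite -sumrB; apply: eq_bigr => j _; rewrite -sumrB; apply: eq_bigr => k _; ring.
by lra.
Qed.

Section LassoAlgebra.
Context {R : realType} {m : nat}.
Variables (Sig : 'I_m -> 'I_m -> R) (W bs : 'I_m -> R) (lam : R).
Hypothesis Sig_sym : forall j k, Sig j k = Sig k j.
Hypothesis Sig_ge0 : forall c : 'I_m -> R, 0 <= \sum_j \sum_k Sig j k * (c j * c k).

(** The LASSO criterion at [bs + D] up to an additive constant, where [Sig] is the empirical
    covariance of the control variates and [W] their covariance with the noise. *)
Definition centered_lasso_obj (D : 'I_m -> R) : R :=
  (\sum_j \sum_k Sig j k * (D j * D k)) / 2 - \sum_j W j * D j + lam * \sum_j `|bs j + D j|.

(** The excess over a stationary point [D] is exactly a Bregman divergence. If moreover [|z| <= 1],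
    both terms are nonnegative, so they vanish at any minimizer [b]. *)
Lemma lasso_kkt (D z b : 'I_m -> R) : 0 <= lam ->
  (forall j, W j - \sum_k Sig j k * D k = lam * z j) ->
  (forall j, z j * (bs j + D j) = `|bs j + D j|) ->
  centered_lasso_obj b - centered_lasso_obj D =
    (\sum_j \sum_k Sig j k * ((b j - D j) * (b k - D k))) / 2
    + lam * \sum_j (`|bs j + b j| - z j * (bs j + b j)).
Proof.
move=> lam0 kkt zD.
have E1 : \sum_j \sum_k Sig j k * ((b j - D j) * (b k - D k)) =
    \sum_j \sum_k Sig j k * (b j * b k) - \sum_j \sum_k Sig j k * (D j * D k)
    - 2 * \sum_j (b j - D j) * \sum_k Sig j k * D k.
  have -> : \sum_j (b j - D j) * \sum_k Sig j k * D k =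
      \sum_j \sum_k Sig j k * (b j * D k) - \sum_j \sum_k Sig j k * (D j * D k).
    rewrite -sumrB; apply: eq_bigr => j _; rewrite mulr_sumr -sumrB.
    by apply: eq_bigr => k _; ring.
  have sw : \sum_j \sum_k Sig j k * (b j * D k) = \sum_j \sum_k Sig j k * (D j * b k).
    rewrite exchange_big /=; apply: eq_bigr => j _; apply: eq_bigr => k _.
    by rewrite Sig_sym (mulrC (b k)).
  have -> : \sum_j \sum_k Sig j k * ((b j - D j) * (b k - D k)) =
     \sum_j \sum_k Sig j k * (b j * b k) - \sum_j \sum_k Sig j k * (b j * D k)
     - \sum_j \sum_k Sig j k * (D j * b k) + \sum_j \sum_k Sig j k * (D j * D k).
    rewrite -!sumrB -big_split /=; apply: eq_bigr => j _.
    by rewrite -!sumrB -big_split /=; apply: eq_bigr => k _; ring.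
  by rewrite -sw; ring.
have E2 : \sum_j (b j - D j) * \sum_k Sig j k * D k =
    \sum_j W j * b j - \sum_j W j * D j - lam * \sum_j z j * (bs j + b j)
    + lam * \sum_j `|bs j + D j|.
  rewrite !mulr_sumr -!sumrB -big_split /=; apply: eq_bigr => j _.
  rewrite -zD; have -> : \sum_k Sig j k * D k = W j - lam * z j by rewrite -kkt; ring.
  by ring.
by rewrite E1 E2 sumrB /centered_lasso_obj; field.
Qed.

Variables (gam kap wb : R) (G : 'I_m -> 'I_m -> R).
Let S := supp bs.
Let ell : R := #|S|%:R.
Hypotheses (gam0 : 0 < gam) (lam0 : 0 < lam) (kap0 : 0 <= kap) (wb0 : 0 <= wb).
Hypothesis ell0 : 0 < ell.
Hypothesis coer : forall c : 'I_m -> R, (forall j, j \notin S -> c j = 0) ->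
  gam * \sum_j c j ^+ 2 <= \sum_j \sum_k G j k * (c j * c k).
Hypothesis Sig_close : forall j k, k \in S -> `|Sig j k - G j k| <= kap * gam / ell.
Hypothesis G_off : forall j k, j \notin S -> k \in S -> G j k = 0.
Hypothesis W_le : forall j, `|W j| <= wb * lam.
Hypothesis kap1 : kap < 1.
Hypothesis incoh : wb * (1 - kap) + kap * (1 + wb) < 1 - kap.
Hypothesis beta_min : forall k, k \in S ->
  (1 + wb) * lam * Num.sqrt ell < (1 - kap) * gam * `|bs k|.

Let Sig_coer (c : 'I_m -> R) : (forall j, j \notin S -> c j = 0) ->
  (1 - kap) * gam * \sum_j c j ^+ 2 <= \sum_j \sum_k Sig j k * (c j * c k).
Proof.
move=> c0; apply: le_trans (form_perturbation ell0 gam0 kap0 c0 (coer c0) Sig_close).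
by rewrite -mulrA ler_wpM2l ?coer // subr_ge0 ltW.
Qed.

(* The identity block off [S] makes the solution vanish there, with no reindexing of [S]. *)
Let restricted_mx : 'M[R]_m :=
  \matrix_(j, k) if (j \in S) && (k \in S) then Sig j k else (j == k)%:R.

Let restricted_unit : restricted_mx \in unitmx.
Proof.
rewrite -row_free_unit -kermx_eq0; apply/rowV0P => v /sub_kermxP vM.
have q0 : ip restricted_mx v v = 0 by rewrite /ip vM mul0mx mxE.
pose c j := if j \in S then v 0 j else 0.
have c0 j : j \notin S -> c j = 0 by rewrite /c => /negPf ->.
have hc := Sig_coer c0.
have E : ip restricted_mx v v = \sum_j \sum_k Sig j k * (c j * c k)
    + \sum_(j | j \notin S) v 0 j ^+ 2.
  rewrite ip_sum [X in _ = _ + X]big_mkcond -big_split /=; apply: eq_bigr => j _.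
  rewrite /c; have [jS|jS] /= := boolP (j \in S).
    rewrite addr0; apply: eq_bigr => k _; rewrite !mxE jS /=.
    by have [kS|kS] := boolP (k \in S); last first;
      rewrite ?mulr0 //; case: eqP => [jk|_]; rewrite ?mul0r //; rewrite -jk jS in kS.
  rewrite (bigD1 j) //= !mxE (negPf jS) eqxx /= mul1r -expr2 big1 => [|k /negPf kj].
    rewrite addr0 big1 ?add0r // => k _; by rewrite mul0r mulr0.
  by rewrite !mxE (negPf jS) /= eq_sym kj mul0r.
have s1 : 0 <= \sum_j c j ^+ 2 by apply: sumr_ge0 => j _; exact: sqr_ge0.
have s2 : 0 <= \sum_(j | j \notin S) v 0 j ^+ 2 by apply: sumr_ge0 => j _; exact: sqr_ge0.
have kg : 0 < (1 - kap) * gam by rewrite mulr_gt0 // subr_gt0.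
have s1' : \sum_j c j ^+ 2 = 0.
  apply/eqP; rewrite eq_le s1 andbT -(pmulr_rle0 _ kg).
  by apply: le_trans hc _; rewrite -[leRHS]q0 E lerDl.
have s2' : \sum_(j | j \notin S) v 0 j ^+ 2 = 0.
  apply/eqP; rewrite eq_le s2 andbT -[leRHS]q0 E lerDr.
  by apply: le_trans hc; rewrite s1' mulr0.
apply/rowP => j; rewrite mxE; have [jS|jS] := boolP (j \in S).
  by have := sum_sqr_eq0 s1' isT : c j = 0; rewrite /c jS.
exact: sum_sqr_eq0 s2' _ jS.
Qed.

Let witness : exists D : 'I_m -> R, (forall j, j \notin S -> D j = 0) /\
  (forall j, j \in S -> \sum_k Sig j k * D k = W j - lam * Num.sg (bs j)).
Proof.
pose b : 'cV[R]_m := \col_j if j \in S then W j - lam * Num.sg (bs j) else 0.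
pose D := invmx restricted_mx *m b.
have MD : restricted_mx *m D = b by rewrite /D mulKVmx.
move: D MD => D MD.
have D0 j : j \notin S -> D j 0 = 0.
  move=> jS; move/matrixP: MD => /(_ j 0); rewrite !mxE (negPf jS) => <-.
  rewrite (bigD1 j) //= !mxE (negPf jS) /= eqxx mul1r big1 ?addr0 // => k /negPf kj.
  by rewrite !mxE (negPf jS) /= eq_sym kj mul0r.
exists (fun j => D j 0); split => // j jS.
move/matrixP: MD => /(_ j 0); rewrite !mxE jS => <-; apply: eq_bigr => k _.
by rewrite !mxE jS /=; case: ifPn => // /D0 ->; rewrite !mulr0.
Qed.

Let sgr_addr (b x : R) : `|x| < `|b| -> Num.sg b * (b + x) = `|b + x|.
Proof.
rewrite ltr_norml => /andP[x1 x2]; case: (sgrP b) => hb; rewrite ?hb.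
- by move: x1 x2; rewrite hb normr0; lra.
- by move: x1 x2; rewrite (gtr0_norm hb) => x1 x2; rewrite mul1r gtr0_norm //; lra.
- by move: x1 x2; rewrite (ltr0_norm hb) => x1 x2; rewrite mulN1r ltr0_norm //; lra.
Qed.

(* Primal-dual witness: solve the stationarity equations on [S] with the signs of [bs], check
   that the solution does not change these signs and is strictly dual feasible off [S]. *)
Lemma lasso_support (b : 'I_m -> R) :
  (forall D, centered_lasso_obj b <= centered_lasso_obj D) ->
  supp (fun j => bs j + b j) = supp bs.
Proof.
move=> bmin; have [D [D0 DS]] := witness.
have [q qE] : exists q, q = (1 - kap) * gam by exists ((1 - kap) * gam).
have [u uE] : exists u, u = (1 + wb) * lam by exists ((1 + wb) * lam).
have q0 : 0 < q by rewrite qE mulr_gt0 // subr_gt0.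
have u0 : 0 <= u by rewrite uE mulr_ge0 ?(ltW lam0) // addr_ge0.
(* Testing the stationarity equations against [D] gives [q * D2 <= u * D1], and
   [D1 ^ 2 <= ell * D2]. Eliminating one norm bounds the other: [D1] by [ell * u / q], [D2] by
   [ell * u ^ 2 / q ^ 2]. *)
set D1 := \sum_j `|D j|; set D2 := \sum_j D j ^+ 2.
have D10 : 0 <= D1 by apply: sumr_ge0.
have h1 : D1 ^+ 2 <= ell * D2 by exact: sqr_sum_norm_le.
have h2 : q * D2 <= u * D1.
  rewrite qE; apply: le_trans (Sig_coer D0) _; rewrite mulr_sumr; apply: ler_sum => j _.
  have -> : \sum_k Sig j k * (D j * D k) = D j * \sum_k Sig j k * D k.
    by rewrite mulr_sumr; apply: eq_bigr => k _; rewrite mulrCA.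
  have [jS|/D0 ->] := boolP (j \in S); last by rewrite mul0r normr0 mulr0.
  rewrite DS // mulrC; apply: le_trans (ler_norm _) _; rewrite normrM ler_wpM2r //.
  apply: le_trans (ler_normB _ _) _; rewrite uE mulrDl mul1r addrC lerD ?W_le //.
  rewrite normrM (gtr0_norm lam0) -[leRHS]mulr1 ler_wpM2l ?(ltW lam0) //.
  by rewrite normr_sg lern1 leq_b1.
have h3 : q * D1 <= ell * u.
  have [D1z|D1z] := eqVneq D1 0; first by rewrite D1z mulr0 mulr_ge0 // ltW.
  have D1p : 0 < D1 by rewrite lt_def D1z.
  rewrite -(ler_pM2r D1p) -mulrA -expr2 -mulrA.
  by apply: le_trans (_ : q * (ell * D2) <= _); [rewrite ler_pM2l|rewrite mulrCA ler_pM2l].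
have h4 : q ^+ 2 * D2 <= ell * u ^+ 2.
  rewrite expr2 -mulrA; apply: le_trans (_ : q * (u * D1) <= _); first by rewrite ler_pM2l.
  by rewrite mulrCA (_ : ell * u ^+ 2 = u * (ell * u)) ?ler_wpM2l //; ring.
have h5 k : k \in S -> `|D k| < `|bs k|.
  move=> kS; rewrite -(ltr_pM2l q0); rewrite [q in ltRHS]qE; apply: le_lt_trans (beta_min kS).
  rewrite -uE.
  rewrite -(ler_pXn2r (n := 2)) ?nnegrE ?mulr_ge0 ?sqrtr_ge0 ?(ltW q0) ?(ltW lam0) ?addr_ge0 //.
  rewrite exprMn [leRHS]exprMn sqr_sqrtr ?(ltW ell0) // [leRHS]mulrC.
  apply: le_trans h4; rewrite ler_wpM2l ?sqr_ge0 // real_normK ?num_real //.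
  by rewrite /D2 (bigD1 k) //= lerDl sumr_ge0 // => j _; exact: sqr_ge0.
pose z j := if j \in S then Num.sg (bs j) else (W j - \sum_k Sig j k * D k) / lam.
have kkt j : W j - \sum_k Sig j k * D k = lam * z j.
  rewrite /z; case: ifPn => [jS|_]; first by rewrite DS // subKr.
  by rewrite mulrCA divff ?mulr1 // gt_eqF.
have bsS j : j \notin S -> bs j = 0 by rewrite inE negbK => /eqP.
have zD j : z j * (bs j + D j) = `|bs j + D j|.
  rewrite /z; case: ifPn => jS; first exact: sgr_addr (h5 _ jS).
  by rewrite bsS // D0 // addr0 mulr0 normr0.
(* Off [S] the entries of [G] against [S] vanish, so those of [Sig] are at most [kap * gam / ell].
   With the bound on [D1] the row acts on [D] by at most [kap * u / (1 - kap)], and [incoh] keeps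
   this plus [wb * lam] below [lam]. *)
have z1 j : j \notin S -> `|z j| < 1.
  move=> jS; rewrite -(ltr_pM2l lam0) -{1}(gtr0_norm lam0) -normrM -kkt mulr1.
  apply: le_lt_trans (ler_normB _ _) _.
  have k1 : 0 < 1 - kap by rewrite subr_gt0.
  have hs : `|\sum_k Sig j k * D k| <= kap * gam / ell * D1.
    apply: le_trans (ler_norm_sum _ _ _) _; rewrite mulr_sumr; apply: ler_sum => k _.
    rewrite normrM; have [kS|/D0 ->] := boolP (k \in S); last by rewrite normr0 !mulr0.
    by rewrite ler_wpM2r //; have := Sig_close j kS; rewrite G_off // subr0.
  have hw := W_le j.
  rewrite -(ltr_pM2l k1).
  have hs2 : (1 - kap) * (kap * gam / ell * D1) <= kap * u.
    have -> : (1 - kap) * (kap * gam / ell * D1) = kap * (q * D1 / ell).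
      by rewrite qE; field; rewrite gt_eqF.
    by rewrite ler_wpM2l // ler_pdivrMr // [leRHS]mulrC.
  apply: (@le_lt_trans _ _ ((1 - kap) * (wb * lam) + kap * u)).
    rewrite mulrDr lerD ?ler_pM2l //; apply: le_trans hs2; by rewrite ler_pM2l.
  have -> : (1 - kap) * (wb * lam) + kap * u = (wb * (1 - kap) + kap * (1 + wb)) * lam.
    by rewrite uE; ring.
  by rewrite ltr_pM2r.
have z1' j : `|z j| <= 1.
  have [jS|jS] := boolP (j \in S); last exact/ltW/z1.
  by rewrite /z jS normr_sg lern1 leq_b1.
have term_ge0 j : 0 <= `|bs j + b j| - z j * (bs j + b j).
  rewrite subr_ge0; apply: le_trans (ler_norm _) _.
  by rewrite normrM -[leRHS]mul1r ler_wpM2r.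
have sum_ge0 : 0 <= \sum_j (`|bs j + b j| - z j * (bs j + b j)) by apply: sumr_ge0.
have quad_ge0 := Sig_ge0 (fun j => b j - D j).
have E := lasso_kkt b (ltW lam0) kkt zD; have := bmin D; rewrite -subr_le0 E => h.
have lsum_ge0 := mulr_ge0 (ltW lam0) sum_ge0.
have sum0 : \sum_j (`|bs j + b j| - z j * (bs j + b j)) = 0.
  apply/eqP; rewrite eq_le sum_ge0 andbT -(pmulr_rle0 _ lam0); lra.
(* The subgradient gap vanishes term by term; off [S] this says [|b j| = z j * b j], which strict
   dual feasibility allows only for [b j = 0]. *)
have bS j : j \notin S -> b j = 0.
  move=> jS; have t0 : `|bs j + b j| - z j * (bs j + b j) = 0.
    by apply: (psumr_eq0P _ sum0) => // i _; exact: term_ge0.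
  move: t0 (z1 j jS); rewrite bsS // add0r => /eqP; rewrite subr_eq0 => /eqP bz zj.
  apply/eqP; rewrite -normr_eq0; apply: contraTT zj => bj0.
  have bjp : 0 < `|b j| by rewrite lt_def bj0 normr_ge0.
  by rewrite -leNgt -(ler_pM2r bjp) mul1r -normrM {1}bz ler_norm.
have cS j : j \notin S -> b j - D j = 0 by move=> jS; rewrite bS // D0 // subrr.
(* [b - D] is now supported on [S], where the quadratic term, known to vanish, is coercive. *)
have sq0 : \sum_j (b j - D j) ^+ 2 = 0.
  apply/eqP; rewrite eq_le sumr_ge0 ?andbT => [|j _]; last exact: sqr_ge0.
  by rewrite -(pmulr_rle0 _ q0) qE; apply: le_trans (Sig_coer cS) _; lra.
have bD j : b j = D j by apply/eqP; rewrite -subr_eq0; apply/eqP; exact: sum_sqr_eq0 sq0 _ isT.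
apply/setP => k; rewrite !inE bD; have [kS|kS] := boolP (k \in S).
  have := h5 k kS; move: kS; rewrite inE => -> hk; apply/eqP => /eqP.
  by rewrite addr_eq0 => /eqP bsD; move: hk; rewrite bsD normrN ltxx.
by rewrite bsS // D0 // addr0.
Qed.

End LassoAlgebra.

(** * Least squares *)

(** First-order condition for a quadratic. Taking [t = a / (b + 1)] instead of [a / b] covers
    [b = 0] as well. *)
Lemma linear_term_eq0 (R : realFieldType) (a b : R) : 0 <= b ->
  (forall t, 0 <= t ^+ 2 * b - 2 * t * a) -> a = 0.
Proof.
move=> b0 h; apply/eqP/negP => /negP a0; have b1 : 0 < b + 1 by lra.
have := h (a / (b + 1)).
have -> : (a / (b + 1)) ^+ 2 * b - 2 * (a / (b + 1)) * a
    = - ((a / (b + 1)) ^+ 2 * (b + 2)) by field; rewrite gt_eqF.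
rewrite oppr_ge0 leNgt mulr_gt0 //; last by lra.
by rewrite exprn_even_gt0 //= mulf_neq0 ?invr_eq0 // gt_eqF.
Qed.

Section DualNorm.
Context {R : realType} {p : nat} (G : 'M[R]_p).
Hypotheses (psdG : psd G) (Gu : G \in unitmx).

Lemma psd_invmx : psd (invmx G).
Proof.
have [Gt G0] := psdG; split; first by rewrite trmx_inv Gt.
move=> u; have -> : ip (invmx G) u u = ip G (u *m invmx G) (u *m invmx G).
  by rewrite /ip trmx_mul trmx_inv Gt mulmxKV // mulmxA.
exact: G0.
Qed.

(** The pairing is the inner product of [v] and [u *m G] for the inverse matrix, and [u *m G] has
    the same norm there as [u] has for [G]. *)
Lemma dual_CauchySchwarz (u v : 'rV[R]_p) :
  `|\sum_i u 0 i * v 0 i| <= nrm (invmx G) v * nrm G u.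
Proof.
have [Gt _] := psdG.
have -> : \sum_i u 0 i * v 0 i = ip (invmx G) v (u *m G).
  rewrite /ip trmx_mul Gt mulmxA mulmxKV // mxE; apply: eq_bigr => i _.
  by rewrite mxE mulrC.
have -> : nrm G u = nrm (invmx G) (u *m G).
  by rewrite /nrm /ip trmx_mul Gt mulmxK // mulmxA.
exact: ip_CauchySchwarz psd_invmx.
Qed.

End DualNorm.

Section LeastSquares.
Context {R : realType} {d : measure_display} {T : measurableType d} {n m : nat}.
Variables (f : T -> R) (h : 'I_m -> T -> R) (bs : 'I_m -> R) (c : R) (eps : T -> R).
Variable x : 'I_n -> T.
Hypothesis fE : forall t, f t = c + lincomb bs h t + eps t.

Definition emp_cov N (g1 g2 : T -> R) : R :=
  emp_mean N (fun t => g1 t * g2 t) x - emp_mean N g1 x * emp_mean N g2 x.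

Lemma emp_covE N g1 g2 : (0 < N <= n)%N -> emp_cov N g1 g2 =
  emp_mean N (fun t => (g1 t - emp_mean N g1 x) * (g2 t - emp_mean N g2 x)) x.
Proof.
move=> Nn; set a := emp_mean N g1 x; set b := emp_mean N g2 x.
have -> : (fun t => (g1 t - a) * (g2 t - b)) =
    fun t => g1 t * g2 t + ((- b) * g1 t + ((- a) * g2 t + a * b)).
  by apply/funext => t; ring.
rewrite !emp_meanD (emp_meanZ N (- b)) (emp_meanZ N (- a)) emp_mean_cst //.
by rewrite /emp_cov /a /b; ring.
Qed.

Lemma emp_mean_sqr_comb N (e : T -> R) (g : 'I_m -> T -> R) (b : 'I_m -> R) :
  emp_mean N (fun t => (e t - \sum_j g j t * b j) ^+ 2) x =
  emp_mean N (fun t => e t * e t) x - 2 * \sum_j emp_mean N (fun t => e t * g j t) x * b j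
  + \sum_j \sum_k emp_mean N (fun t => g j t * g k t) x * (b j * b k).
Proof.
have -> : (fun t => (e t - \sum_j g j t * b j) ^+ 2) =
    fun t => e t * e t + ((- 2) * \sum_j b j * (e t * g j t)
      + \sum_j \sum_k (b j * b k) * (g j t * g k t)).
  apply/funext => t.
  have -> : \sum_j b j * (e t * g j t) = e t * \sum_j g j t * b j.
    by rewrite mulr_sumr; apply: eq_bigr => j _; ring.
  have -> : \sum_j \sum_k (b j * b k) * (g j t * g k t) = (\sum_j g j t * b j) ^+ 2.
    rewrite expr2 mulr_suml; apply: eq_bigr => j _; rewrite mulr_sumr.
    by apply: eq_bigr => k _; ring.
  by ring.
rewrite !emp_meanD emp_meanZ !emp_mean_sum -addrA; congr (_ + (_ + _)).
  rewrite -mulNr; congr (_ * _); apply: eq_bigr => j _.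
  by rewrite emp_meanZ mulrC.
apply: eq_bigr => j _; rewrite emp_mean_sum; apply: eq_bigr => k _.
by rewrite emp_meanZ mulrC.
Qed.

(** Centering removes the constant [c], and shifting by [bs] removes the explained part of [f]; what
    remains is a regression of [eps] on [h] with coefficients [b]. *)
Lemma lasso_objE N lam (b : 'I_m -> R) : (0 < N <= n)%N ->
  lasso_obj N f h lam x (fun j => bs j + b j) =
  emp_cov N eps eps / 2 +
  centered_lasso_obj (fun j k => emp_cov N (h j) (h k)) (fun j => emp_cov N eps (h j)) bs lam b.
Proof.
move=> Nn; have N0 : N%:R != 0 :> R by rewrite pnatr_eq0 -lt0n; case/andP: Nn.
rewrite /lasso_obj /centered_lasso_obj.
have -> : (2 * N%:R)^-1 * \sum_(i < n | (i < N)%N) (f (x i) - (\sum_(i < n | (i < N)%N) f (x i)) / N%:R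
   - \sum_(j < m) (h j (x i) - (\sum_(i < n | (i < N)%N) h j (x i)) / N%:R) * (bs j + b j)) ^+ 2
  = emp_mean N (fun t => ((eps t - emp_mean N eps x)
      - \sum_j (h j t - emp_mean N (h j) x) * b j) ^+ 2) x / 2.
  rewrite /emp_mean invfM mulrC mulrA mulrAC; congr (_ / _ / _); apply: eq_bigr => i _.
  rewrite -/(emp_mean N f x) -/(emp_mean N eps x); congr (_ ^+ 2).
  have -> : emp_mean N f x = c + \sum_j bs j * emp_mean N (h j) x + emp_mean N eps x.
    rewrite (eq_emp_mean _ _ fE) !emp_meanD emp_mean_cst // emp_mean_sum.
    by congr (_ + _ + _); apply: eq_bigr => j _; rewrite emp_meanZ.
  rewrite fE /lincomb.
  under [\sum_(j < m) _ * (bs j + b j)]eq_bigr => j _.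
    rewrite mulrDr mulrBl (mulrC (h j _) (bs j)) (mulrC _ (bs j)); over.
  by rewrite big_split sumrB /= -/(emp_mean _ _ _); ring.
have E1 : \sum_j emp_mean N (fun t => (eps t - emp_mean N eps x) * (h j t - emp_mean N (h j) x)) x
    * b j = \sum_j emp_cov N eps (h j) * b j.
  by apply: eq_bigr => j _; rewrite emp_covE.
have E2 : \sum_j \sum_k emp_mean N (fun t => (h j t - emp_mean N (h j) x)
    * (h k t - emp_mean N (h k) x)) x * (b j * b k)
    = \sum_j \sum_k emp_cov N (h j) (h k) * (b j * b k).
  by apply: eq_bigr => j _; apply: eq_bigr => k _; rewrite emp_covE.
by rewrite emp_mean_sqr_comb E1 E2 -emp_covE //; field.
Qed.

Lemma emp_cov_psd N (b : 'I_m -> R) : (0 < N <= n)%N ->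
  0 <= \sum_j \sum_k emp_cov N (h j) (h k) * (b j * b k).
Proof.
move=> Nn; have := @emp_mean_ge0 _ _ _ N (fun t =>
  (0 - \sum_j (h j t - emp_mean N (h j) x) * b j) ^+ 2) x (fun t => sqr_ge0 _).
rewrite (emp_mean_sqr_comb N (fun=> 0)).
under [X in _ - _ * X]eq_bigr => j _.
  rewrite (_ : emp_mean _ _ _ = 0); last first.
    by rewrite /emp_mean big1 ?mul0r // => i _; rewrite mul0r.
  rewrite mul0r; over.
rewrite (_ : emp_mean N (fun=> 0 * 0) x = 0); last first.
  by rewrite /emp_mean big1 ?mul0r // => i _; rewrite mul0r.
rewrite big1 // mulr0 subrr add0r => h0; apply: le_trans h0 _.
rewrite le_eqVlt; apply/orP; left; apply/eqP.
by apply: eq_bigr => j _; apply: eq_bigr => k _; rewrite emp_covE.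
Qed.

Variables (S : {set 'I_m}) (alpha : R) (beta : 'I_m -> R).
Hypotheses (bsS : forall j, j \notin S -> bs j = 0) (n0 : (0 < n)%N).
Hypothesis ols : is_lslasso f h x S alpha beta.
Let b j := beta j - bs j.
Let r t := eps t - (alpha - c) - \sum_j h j t * b j.

(** Along the line through the estimator in direction [(a', b')] the criterion is a quadratic
    minimal at 0, so its linear term vanishes. *)
Lemma ols_normal (a' : R) (b' : 'I_m -> R) : (forall j, j \notin S -> b' j = 0) ->
  emp_mean n (fun t => r t * (a' + \sum_j h j t * b' j)) x = 0.
Proof.
move=> b'S; have [betaS omin] := ols.
pose u t := a' + \sum_j h j t * b' j.
suff : \sum_(i < n) r (x i) * u (x i) = 0.
  rewrite /emp_mean => E; rewrite (eq_bigl xpredT) ?E ?mul0r // => i.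
  by rewrite ltn_ord.
apply: (@linear_term_eq0 _ _ (\sum_(i < n) u (x i) ^+ 2)).
  by apply: sumr_ge0 => i _; exact: sqr_ge0.
move=> t.
have E s : ols_obj f h x (alpha + s * a') (fun j => beta j + s * b' j)
    = \sum_(i < n) r (x i) ^+ 2
      + (s ^+ 2 * \sum_(i < n) u (x i) ^+ 2 - 2 * s * \sum_(i < n) r (x i) * u (x i)).
  rewrite !mulr_sumr -sumrB -big_split /=; apply: eq_bigr => i _.
  rewrite fE /lincomb /r /u /b.
  have -> : \sum_j h j (x i) * (beta j + s * b' j)
      = \sum_j h j (x i) * beta j + s * \sum_j h j (x i) * b' j.
    by rewrite mulr_sumr -big_split; apply: eq_bigr => j _ /=; ring.
  have -> : \sum_j h j (x i) * (beta j - bs j)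
      = \sum_j h j (x i) * beta j - \sum_j bs j * h j (x i).
    by rewrite -sumrB; apply: eq_bigr => j _; ring.
  by ring.
have S' j : j \notin S -> beta j + t * b' j = 0.
  by move=> jS; rewrite betaS // b'S // mulr0 addr0.
have := omin (alpha + t * a') _ S'.
have <- : ols_obj f h x (alpha + 0 * a') (fun j => beta j + 0 * b' j) = ols_obj f h x alpha beta.
  by rewrite mul0r addr0; congr ols_obj; apply/funext => j; rewrite mul0r addr0.
by rewrite !E expr0n /= mul0r mulr0 mul0r subrr addr0 lerDl.
Qed.

(** Here [s] stands for the Gram norm of [b]. Testing the residual against 1 gives
    [alpha - c = mean eps - hb]; testing it against the fitted part gives
    [q = w - (alpha - c) * hb]. Substituting the first into the second produces
    [hb ^ 2 <= eta ^ 2 * s ^ 2], absorbed on the left, so that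
    [(1 - kap - eta ^ 2) * s <= om + e * eta]. *)
Lemma ols_bound (s kap eta om e : R) : 0 <= s -> 0 <= eta ->
  (1 - kap) * s ^+ 2 <= \sum_j \sum_k emp_mean n (fun t => h j t * h k t) x * (b j * b k) ->
  `|\sum_j emp_mean n (h j) x * b j| <= eta * s ->
  `|\sum_j emp_mean n (fun t => eps t * h j t) x * b j| <= om * s ->
  `|emp_mean n eps x| <= e -> 0 < 1 - kap - eta ^+ 2 -> 0 <= om ->
  `|alpha - c| <= e + eta * (om + e * eta) / (1 - kap - eta ^+ 2).
Proof.
move=> s0 eta0 hq hh hw he den0 om0.
set q := \sum_j \sum_k _ in hq; set hb := \sum_j _ in hh; set w := \sum_j _ in hw.
have nn : (0 < n <= n)%N by rewrite n0 leqnn.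
have bS j : j \notin S -> b j = 0.
  by move=> jS; rewrite /b bsS // (ols.1 _ jS) subrr.
have := @ols_normal 1 (fun=> 0) (fun _ _ => erefl).
have -> : (fun t => r t * (1 + \sum_j h j t * 0)) =
    fun t => eps t + ((-1) * (alpha - c) + (-1) * \sum_j b j * h j t).
  apply/funext => t; rewrite big1 => [|j _]; last by rewrite mulr0.
  by rewrite /r (eq_bigr _ (fun j _ => mulrC (h j t) (b j))); ring.
rewrite !emp_meanD emp_mean_cst // emp_meanZ emp_mean_sum.
have -> : \sum_j emp_mean n (fun t => b j * h j t) x = hb.
  by apply: eq_bigr => j _; rewrite emp_meanZ mulrC.
move=> N1.
have := @ols_normal 0 b bS.
have -> : (fun t => r t * (0 + \sum_j h j t * b j)) =
    fun t => \sum_j b j * (eps t * h j t) + ((- (alpha - c)) * \sum_j b j * h j t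
      + (-1) * \sum_j \sum_k (b j * b k) * (h j t * h k t)).
  apply/funext => t.
  have -> : \sum_j b j * (eps t * h j t) = eps t * \sum_j h j t * b j.
    by rewrite mulr_sumr; apply: eq_bigr => j _; ring.
  have -> : \sum_j \sum_k (b j * b k) * (h j t * h k t) = (\sum_j h j t * b j) ^+ 2.
    rewrite expr2 mulr_suml; apply: eq_bigr => j _; rewrite mulr_sumr.
    by apply: eq_bigr => k _; ring.
  by rewrite /r (eq_bigr _ (fun j _ => mulrC (b j) (h j t))); ring.
rewrite !emp_meanD !emp_meanZ !emp_mean_sum.
have -> : \sum_j emp_mean n (fun t => b j * h j t) x = hb.
  by apply: eq_bigr => j _; rewrite emp_meanZ mulrC.
have -> : \sum_j emp_mean n (fun t => b j * (eps t * h j t)) x = w.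
  by apply: eq_bigr => j _; rewrite emp_meanZ mulrC.
have -> : \sum_j emp_mean n (fun t => \sum_k (b j * b k) * (h j t * h k t)) x = q.
  apply: eq_bigr => j _; rewrite emp_mean_sum; apply: eq_bigr => k _.
  by rewrite emp_meanZ mulrC.
move=> N2.
have aE : alpha - c = emp_mean n eps x - hb by lra.
have e0 : 0 <= e := le_trans (normr_ge0 _) he.
have key : (1 - kap - eta ^+ 2) * s <= om + e * eta.
  have [->|sn0] := eqVneq s 0; first by rewrite mulr0 addr_ge0 ?mulr_ge0.
  have sp : 0 < s by rewrite lt_def sn0.
  rewrite -(ler_pM2r sp).
  have hb2 : hb ^+ 2 <= (eta * s) ^+ 2.
    by rewrite -(real_normK (num_real hb)) lerXn2r ?nnegrE ?mulr_ge0.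
  have eh : `|emp_mean n eps x * hb| <= e * (eta * s) by rewrite normrM ler_pM.
  have := ler_norm w; have := ler_norm (- (emp_mean n eps x * hb)); rewrite normrN.
  have qE : q = w - emp_mean n eps x * hb + hb ^+ 2 by move: N2; rewrite aE; lra.
  have -> : (1 - kap - eta ^+ 2) * s * s = (1 - kap) * s ^+ 2 - (eta * s) ^+ 2 by ring.
  have -> : (om + e * eta) * s = om * s + e * (eta * s) by ring.
  by lra.
rewrite aE; apply: le_trans (ler_normB _ _) _; apply: lerD => //.
apply: le_trans hh _; rewrite -mulrA ler_wpM2l // ler_pdivlMr //.
by rewrite mulrC.
Qed.

End LeastSquares.

(** * Population quantities *)

Lemma sum_enum_val (R : nmodType) (m : nat) (S : {set 'I_m}) (F : 'I_m -> R) :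
  (forall j, j \notin S -> F j = 0) -> \sum_j F j = \sum_(i < #|S|) F (enum_val i).
Proof.
move=> F0; rewrite -big_enum_val [RHS]big_mkcond /=; apply: eq_bigr => j _.
by case: ifPn => // /F0.
Qed.

Section Population.
Context {R : realType} {d : measure_display} {T : measurableType d}.
Variables (P : probability T R) (m : nat) (f : T -> R) (h : 'I_m -> T -> R) (bs : 'I_m -> R).
Hypothesis f2 : in_L2 P f.
Hypothesis mh : forall j, measurable_fun setT (h j).
Hypothesis hbd : exists M : R, forall j x, `|h j x| <= M.

Lemma le_Uh j t : `|h j t| <= Uh h.
Proof.
have [M hM] := hbd; apply: (@le_trans _ _ (sup [set `|h j x| | x in [set: T]])).
  apply: ub_le_sup; last by exists t.
  by exists M => _ [x _ <-]; exact: hM.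
by rewrite /Uh (bigD1 j) //= le_max lexx.
Qed.

Lemma Uh_ge0 : 0 <= Uh h.
Proof. exact: bigmax_ge_id. Qed.

Lemma summable_h j : summable_rv P (h j).
Proof. exact: (summable_bounded P (mh j) (fun t => le_Uh j t)). Qed.

Lemma le_hh j k t : `|h j t * h k t| <= Uh h ^+ 2.
Proof. by rewrite normrM expr2 ler_pM ?le_Uh. Qed.

Lemma summable_hh j k : summable_rv P (fun t => h j t * h k t).
Proof.
by apply: summable_bounded (measurable_funM (mh j) (mh k)) _ => t; exact: le_hh.
Qed.

Lemma measurable_lincomb b : measurable_fun setT (lincomb b h).
Proof. by apply: measurable_sum => j; apply: measurable_funM. Qed.

Lemma lincomb_bounded b t : `|lincomb b h t| <= \sum_j `|b j| * Uh h.
Proof.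
apply: le_trans (ler_norm_sum _ _ _) _; apply: ler_sum => j _.
by rewrite normrM ler_wpM2l // le_Uh.
Qed.

Let eps t := f t - Pexp P f - lincomb bs h t.

Lemma measurable_noise : measurable_fun setT eps.
Proof.
apply: measurable_funB (measurable_lincomb bs).
by apply: measurable_funB; [case: f2|exact: measurable_cst].
Qed.

Lemma summable_noise_sqr : summable_rv P (fun t => eps t ^+ 2).
Proof.
have [mf sf2] := f2.
pose C := (`|Pexp P f| + \sum_j `|bs j| * Uh h) ^+ 2.
have s1 : summable_rv P (fun t => 2 * f t ^+ 2) := summableZ 2 sf2.
have s2 := summableD s1 (summable_cst P (2 * C)).
apply: summable_dom s2 _ => [|t]; first exact: measurable_funX measurable_noise.
rewrite ger0_norm ?sqr_ge0 //.
have hb : (Pexp P f + lincomb bs h t) ^+ 2 <= C.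
  rewrite -(real_normK (num_real (_ + _))) lerXn2r ?nnegrE //.
    by rewrite addr_ge0 ?sumr_ge0 // => j _; rewrite mulr_ge0 ?Uh_ge0.
  by apply: le_trans (ler_normD _ _) _; rewrite lerD2l lincomb_bounded.
apply: (@le_trans _ _ (2 * f t ^+ 2 + 2 * (Pexp P f + lincomb bs h t) ^+ 2)); last by lra.
have : 0 <= (f t + (Pexp P f + lincomb bs h t)) ^+ 2 by exact: sqr_ge0.
by rewrite /eps; lra.
Qed.

Lemma summable_noise_h j : summable_rv P (fun t => eps t * h j t).
Proof.
have s := summableD summable_noise_sqr (summable_hh j j).
apply: summable_dom s _ => [|t]; first exact: measurable_funM measurable_noise (mh j).
have : 0 <= (`|eps t| - `|h j t|) ^+ 2 by exact: sqr_ge0.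
rewrite normrM -expr2 -(real_normK (num_real (eps t))) -(real_normK (num_real (h j t))).
have := mulr_ge0 (normr_ge0 (eps t)) (normr_ge0 (h j t)); lra.
Qed.

Hypothesis bs_min : forall b : 'I_m -> R, (cv_risk P f h bs <= cv_risk P f h b)%E.

(** First-order condition for the risk along coordinate [k]. It is needed also for [k] outside [S],
    since dual feasibility of the LASSO concerns the inactive control variates. *)
Lemma noise_orthogonal k : Pexp P (fun t => eps t * h k t) = 0.
Proof.
have s1 := summable_noise_sqr; have s2 := summable_noise_h k; have s3 := summable_hh k k.
apply: (@linear_term_eq0 _ _ (Pexp P (fun t => h k t * h k t))).
  rewrite -lee_fin -PexpE //; apply: integral_ge0 => t _.
  by rewrite lee_fin -expr2 sqr_ge0.
move=> a; have := bs_min (fun j => bs j + (if j == k then a else 0)).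
have E t : (f t - Pexp P f - lincomb (fun j => bs j + (if j == k then a else 0)) h t) ^+ 2
    = eps t ^+ 2 + ((- 2 * a) * (eps t * h k t) + a ^+ 2 * (h k t * h k t)).
  have -> : lincomb (fun j => bs j + (if j == k then a else 0)) h t = lincomb bs h t + a * h k t.
    rewrite /lincomb (bigD1 k) //= [in RHS](bigD1 k) //= eqxx.
    have -> : \sum_(i < m | i != k) (bs i + (if i == k then a else 0)) * h i t
        = \sum_(i < m | i != k) bs i * h i t.
      by apply: eq_bigr => j /negPf ->; rewrite addr0.
    by ring.
  by rewrite /eps; ring.
have s4 := summableZ (- 2 * a) s2; have s5 := summableZ (a ^+ 2) s3.
have s45 := summableD s4 s5.
have -> : cv_risk P f h bs = (Pexp P (fun t => eps t ^+ 2))%:E := PexpE s1.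
have -> : cv_risk P f h (fun j => bs j + (if j == k then a else 0)) =
    (Pexp P (fun t => eps t ^+ 2
      + ((- 2 * a) * (eps t * h k t) + a ^+ 2 * (h k t * h k t))))%:E.
  rewrite -PexpE; last exact: summableD.
  by apply: eq_integral => t _; rewrite E.
rewrite lee_fin PexpD // PexpD // !PexpZ // lerDl; lra.
Qed.

Variable S : {set 'I_m}.
Let G := Gram P h S.
Let hv (u : 'rV[R]_#|S|) (t : T) : R := \sum_i u 0 i * h (enum_val i) t.

Let hv_sqrE u : (fun t => hv u t ^+ 2) =
  fun t => \sum_i \sum_k (u 0 i * u 0 k) * (h (enum_val i) t * h (enum_val k) t).
Proof.
apply/funext => t; rewrite expr2 mulr_suml; apply: eq_bigr => i _; rewrite mulr_sumr.
by apply: eq_bigr => k _; ring.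
Qed.

Let summable_hv_sqr u : summable_rv P (fun t => hv u t ^+ 2).
Proof.
rewrite hv_sqrE; apply: summable_sum => i _; apply: summable_sum => k _.
exact: summableZ (summable_hh _ _).
Qed.

Lemma ip_Gram u : ip G u u = Pexp P (fun t => hv u t ^+ 2).
Proof.
rewrite hv_sqrE.
have s i k := summableZ (u 0 i * u 0 k) (summable_hh (enum_val i) (enum_val k)).
rewrite Pexp_sum => [|i]; last by apply: summable_sum => k _; exact: s.
rewrite ip_sum; apply: eq_bigr => i _; rewrite Pexp_sum //; apply: eq_bigr => k _.
by rewrite PexpZ ?mxE 1?mulrC //; exact: summable_hh.
Qed.

Lemma Gram_sym : G^T = G.
Proof. by apply/matrixP => i k; rewrite !mxE; apply: eq_Pexp => t; rewrite mulrC. Qed.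

Lemma psd_Gram : psd G.
Proof.
split; first exact: Gram_sym.
move=> u; rewrite ip_Gram -[leLHS](Pexp_cst P).
by apply: Pexp_le => [||t]; [exact: summable_cst|exact: summable_hv_sqr|exact: sqr_ge0].
Qed.

Hypothesis free : forall c : 'I_m -> R, (forall j, j \notin S -> c j = 0) ->
  {ae P, forall x, lincomb c h x = 0} -> forall j, c j = 0.

Lemma Gram_posdef u : ip G u u = 0 -> u = 0.
Proof.
rewrite ip_Gram => u0.
(* Extension of [u] by zero off [S]: the sum has one term when [j] is in [S] and none otherwise. *)
pose c j := \sum_(i < #|S| | enum_val i == j) u 0 i.
have cE i : c (enum_val i) = u 0 i.
  by rewrite /c (big_pred1 i) // => k; rewrite (inj_eq enum_val_inj).
have c0 j : j \notin S -> c j = 0.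
  by move=> jS; rewrite /c big_pred0 // => i; apply: contraNF jS => /eqP <-; exact: enum_valP.
have lc t : lincomb c h t = hv u t.
  rewrite /lincomb (sum_enum_val (S := S)) => [|j /c0 ->]; last by rewrite mul0r.
  by apply: eq_bigr => i _; rewrite cE.
suff ae0 : {ae P, forall x, lincomb c h x = 0}.
  by apply/rowP => i; rewrite mxE -cE free.
have mh2 : measurable_fun setT (fun t => (hv u t ^+ 2)%:E).
  by apply/measurable_EFinP; exact: summable_measurable (summable_hv_sqr u).
have := PexpE (summable_hv_sqr u); rewrite u0 => i0.
have : ae_eq P setT (fun t => (hv u t ^+ 2)%:E) (cst 0%E).
  apply/(ae_eq_integral_abs P measurableT mh2); rewrite -[RHS]i0.
  by apply: eq_integral => t _; rewrite gee0_abs // lee_fin sqr_ge0.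
apply: filterS => t /(_ I) /= [] /eqP; rewrite sqrf_eq0 lc => /eqP //.
Qed.

Lemma Gram_unit : G \in unitmx.
Proof.
rewrite -row_free_unit -kermx_eq0; apply/rowV0P => v /sub_kermxP vM.
by apply: Gram_posdef; rewrite /ip vM mul0mx mxE.
Qed.

Hypothesis S0 : S != finset.set0.
Let gam := lambda_min G.
Let ell : R := #|S|%:R.

Let cardS_gt0 : (0 < #|S|)%N. Proof. by rewrite card_gt0. Qed.

Lemma lambda_min_Gram_gt0 : 0 < gam.
Proof.
have [v [v0 vE _]] := lambda_min_attained Gram_sym cardS_gt0.
rewrite -(pmulr_lgt0 _ (ip1_gt0 v0)) -/G -vE lt_def psd_Gram.2 andbT.
by apply: contra v0 => /eqP /Gram_posdef ->.
Qed.

Lemma Gram_coercive u : gam * ip 1%:M u u <= ip G u u.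
Proof. by have [v [_ _]] := lambda_min_attained Gram_sym cardS_gt0; apply. Qed.

Lemma ip_Gram_fun (c : 'I_m -> R) (F : 'I_m -> 'I_m -> R) :
  (forall j, j \notin S -> c j = 0) ->
  \sum_j \sum_k F j k * (c j * c k) =
  \sum_(i < #|S|) \sum_(k < #|S|) F (enum_val i) (enum_val k)
     * (c (enum_val i) * c (enum_val k)).
Proof.
move=> c0; rewrite (sum_enum_val (S := S)) => [|j /c0 cj]; last first.
  by rewrite big1 // => k _; rewrite cj mul0r mulr0.
apply: eq_bigr => i _; rewrite (sum_enum_val (S := S)) // => j /c0 ->.
by rewrite !mulr0.
Qed.

Lemma Gram_fun (c : 'I_m -> R) : (forall j, j \notin S -> c j = 0) ->
  ip G (\row_i c (enum_val i)) (\row_i c (enum_val i)) =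
  \sum_j \sum_k Pexp P (fun t => h j t * h k t) * (c j * c k).
Proof.
move=> c0; rewrite ip_Gram_fun // ip_sum; apply: eq_bigr => i _; apply: eq_bigr => k _.
by rewrite !mxE.
Qed.

Lemma Gram_coercive_fun (c : 'I_m -> R) : (forall j, j \notin S -> c j = 0) ->
  gam * \sum_j c j ^+ 2 <= \sum_j \sum_k Pexp P (fun t => h j t * h k t) * (c j * c k).
Proof.
move=> c0; rewrite -Gram_fun //; apply: le_trans (Gram_coercive _).
rewrite ip1E (sum_enum_val (S := S)) => [|j /c0 ->]; last by rewrite expr0n.
by under [X in _ <= _ * X]eq_bigr do rewrite mxE.
Qed.

Let xi := ell * Uh h ^+ 2 / gam.
Let B := Bstar P h S.
Let q t := ip (invmx G) (hS h S t) (hS h S t).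

(** With [w = v *m invmx G], one has [q = <w, v>] and [gam * |w| ^ 2 <= ip G w w = q], hence
    [gam * q ^ 2 <= q * |v| ^ 2]. This also bounds the set whose supremum is [Bstar], so that [sup]
    is not a default value. *)
Lemma ip_hS_le_xi t : q t <= xi.
Proof.
have pI := psd_invmx psd_Gram Gram_unit; have g0 := lambda_min_Gram_gt0.
set v := hS h S t; set w := v *m invmx G.
have q0 : 0 <= q t := pI.2 v.
have wq : ip G w w = q t.
  by rewrite /ip /w trmx_mul trmx_inv Gram_sym mulmxKV ?Gram_unit // mulmxA.
have qv : q t = ip 1%:M w v by rewrite /ip mulmx1.
have v2 : ip 1%:M v v <= ell * Uh h ^+ 2.
  rewrite ip1E; apply: (@le_trans _ _ (\sum_(i < #|S|) Uh h ^+ 2)).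
    apply: ler_sum => i _; rewrite mxE -(real_normK (num_real (h _ t))).
    by rewrite lerXn2r ?nnegrE ?le_Uh ?Uh_ge0.
  by rewrite sumr_const card_ord -mulr_natl.
have p1 := @psd1 R #|S|.
have cs : q t ^+ 2 <= ip 1%:M w w * ip 1%:M v v.
  rewrite -!nrm_sqr // -exprMn qv -(real_normK (num_real (ip _ _ _))).
  by rewrite lerXn2r ?nnegrE ?mulr_ge0 ?nrm_ge0 //; exact: ip_CauchySchwarz.
have := Gram_coercive w; rewrite wq => gw.
have w0 := ip1_ge0 w.
have [->|qn0] := eqVneq (q t) 0.
  apply: divr_ge0; last exact: ltW.
  by apply: mulr_ge0; [exact: ler0n|exact: sqr_ge0].
have qp : 0 < q t by rewrite lt_def qn0.
rewrite ler_pdivlMr // -(ler_pM2r qp).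
apply: (@le_trans _ _ (gam * (ip 1%:M w w * ip 1%:M v v))).
  by rewrite (_ : q t * gam * q t = gam * q t ^+ 2) ?ler_pM2l //; ring.
rewrite mulrA [leRHS]mulrC; apply: ler_pM => //; first by rewrite mulr_ge0 // ltW.
exact: ip1_ge0.
Qed.

Let q_sup : has_sup [set q t | t in [set: T]].
Proof.
split; first by exists (q point); exists point.
by exists xi => _ [t _ <-]; exact: ip_hS_le_xi.
Qed.

Lemma ip_hS_le_Bstar t : q t <= B.
Proof. by apply: ub_le_sup; [case: q_sup|exists t]. Qed.

Lemma Bstar_le_xi : B <= xi.
Proof.
apply: ge_sup; first by case: q_sup.
by move=> _ [t _ <-]; exact: ip_hS_le_xi.
Qed.

Let q_sum t : q t = \sum_i \sum_k invmx G i k * (h (enum_val i) t * h (enum_val k) t).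
Proof. by rewrite /q ip_sum; apply: eq_bigr => i _; apply: eq_bigr => k _; rewrite !mxE. Qed.

Lemma summable_ip_hS : summable_rv P q.
Proof.
rewrite (funext q_sum); apply: summable_sum => i _; apply: summable_sum => k _.
exact: summableZ (summable_hh _ _).
Qed.

(** The expectation is the trace of [invmx G *m G]. It is the variance proxy in the Bernstein bound
    for the mean of [h]. *)
Lemma Pexp_ip_hS : Pexp P q = ell.
Proof.
have s i k := summableZ (invmx G i k) (summable_hh (enum_val i) (enum_val k)).
rewrite (funext q_sum) Pexp_sum => [|i]; last by apply: summable_sum => k _; exact: s.
have -> : ell = \tr (invmx G *m G) by rewrite mulVmx ?Gram_unit // mxtrace1.
apply: eq_bigr => i _; rewrite Pexp_sum // mxE; apply: eq_bigr => k _.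
rewrite PexpZ ?mxE; last exact: summable_hh.
by congr (_ * _); apply: eq_Pexp => t; rewrite mulrC.
Qed.

Lemma ell_le_Bstar : ell <= B.
Proof.
rewrite -Pexp_ip_hS -[leRHS](Pexp_cst P).
by apply: Pexp_le ip_hS_le_Bstar; [exact: summable_ip_hS|exact: summable_cst].
Qed.

Lemma Uh_gt0 : 0 < Uh h.
Proof.
rewrite lt_def Uh_ge0 andbT; apply/eqP => U0.
have := le_trans ell_le_Bstar Bstar_le_xi.
by rewrite /xi U0 expr0n mulr0 mul0r leNgt ltr0n cardS_gt0.
Qed.

End Population.

(** * High-probability events *)

Lemma expRN_ln (R : realType) (x : R) : 0 < x -> expR (- ln x) = x^-1.
Proof. by move=> x0; rewrite expRN lnK. Qed.

(** The origin of 75: after squaring, [2 / 75 <= 1 / 36]. *)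
Lemma sqrt_rate_le (R : rcfType) (xi L k : R) : 0 <= xi -> 0 <= L -> 0 < k ->
  75 * xi ^+ 2 * L <= k -> Num.sqrt (2 * L / k) * xi <= 1 / 6.
Proof.
move=> xi0 L0 k0 h; rewrite -(ler_pXn2r (n := 2)) ?nnegrE ?mulr_ge0 ?sqrtr_ge0 //.
rewrite exprMn sqr_sqrtr; last by rewrite divr_ge0 ?mulr_ge0 // ltW.
by rewrite mulrAC ler_pdivrMr //; lra.
Qed.

Section Lslasso.
Context {R : realType} {d : measure_display} {T : measurableType d}.
Variables (P : probability T R) (m : nat) (f : T -> R) (h : 'I_m -> T -> R).
Variables (bs : 'I_m -> R) (tau : R).
Context {dO : measure_display} {Omega : measurableType dO} {Q : probability Omega R}.
Context {n : nat} {X : 'I_n -> Omega -> T}.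
Hypothesis f2 : in_L2 P f.
Hypothesis mh : forall j, measurable_fun setT (h j).
Hypothesis h0 : forall j, Pexp P (h j) = 0.
Hypothesis bs_min : forall b : 'I_m -> R, (cv_risk P f h bs <= cv_risk P f h b)%E.
Let eps t := f t - Pexp P f - lincomb bs h t.
Let S := supp bs.
Hypothesis S0 : S != finset.set0.
Hypotheses (tau0 : 0 < tau) (sg : subgaussian P eps tau).
Hypothesis hbd : exists M : R, forall j x, `|h j x| <= M.
Hypothesis free : forall c : 'I_m -> R, (forall j, j \notin S -> c j = 0) ->
  {ae P, forall x, lincomb c h x = 0} -> forall j, c j = 0.
Hypothesis iidX : iid_sample Q P X.
Let ell : R := #|S|%:R.
Let U := Uh h.
Let gam := lambda_min (Gram P h S).
Let xi := ell * U ^+ 2 / gam.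
Let B := Bstar P h S.
Let G j k := Pexp P (fun t => h j t * h k t).

Let gam0 : 0 < gam := lambda_min_Gram_gt0 mh hbd free S0.
Let U0 : 0 < U := Uh_gt0 mh hbd free S0.
Let ell1 : 1 <= ell. Proof. by rewrite ler1n card_gt0. Qed.
Let ell0 : 0 < ell. Proof. exact: lt_le_trans ltr01 ell1. Qed.
Let ellB : ell <= B := ell_le_Bstar mh hbd free S0.
Let Bxi : B <= xi := Bstar_le_xi mh hbd free S0.
Let xi1 : 1 <= xi := le_trans ell1 (le_trans ellB Bxi).
Let ellm : ell <= m%:R.
Proof. by rewrite ler_nat -[leqRHS]card_ord max_card. Qed.
Let meps : measurable_fun setT eps := measurable_noise bs f2 mh.
Let fE t : f t = Pexp P f + lincomb bs h t + eps t.
Proof. by rewrite /eps; ring. Qed.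
Let U2E : 2 * U ^+ 2 = 2 * xi * gam / ell.
Proof. by rewrite /xi; field; rewrite !gt_eqF. Qed.

(** The union bound runs over [m * ell] pairs only, one index being in [S]; this accounts for the
    product [ell * m] inside the logarithm of the sample-size condition. *)
Lemma gram_whp k L : (0 < k <= n)%N -> 0 <= L ->
  fails_wp_le Q (m%:R * ell * (2 * expR (- L)))
    (fun w => forall i j, j \in S ->
      `|emp_mean k (fun t => h i t * h j t) (X ^~ w) - G i j|
        <= 2 * U ^+ 2 * Num.sqrt (2 * L / k%:R)).
Proof.
move=> kn L0.
have ev (ij : 'I_m * 'I_#|S|) : fails_wp_le Q (2 * expR (- L)) (fun w =>
    `|emp_mean k (fun t => h ij.1 t * h (enum_val ij.2) t - G ij.1 (enum_val ij.2)) (X ^~ w)|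
     <= 2 * U ^+ 2 * Num.sqrt (2 * L / k%:R)).
  set i := ij.1; set j := enum_val ij.2.
  have s1 := summable_hh P mh hbd i j; have s2 := summable_cst P (- G i j).
  have b1 t : `|h i t * h j t| <= U ^+ 2 := le_hh hbd i j t.
  have b2 : `|G i j| <= U ^+ 2.
    rewrite ler_norml /G; apply/andP; split.
      rewrite -[leLHS](Pexp_cst P); apply: Pexp_le => //; first exact: summable_cst.
      by move=> t; have := b1 t; rewrite ler_norml => /andP[].
    rewrite -[leRHS](Pexp_cst P); apply: Pexp_le => //; first exact: summable_cst.
    by move=> t; have := b1 t; rewrite ler_norml => /andP[].
  apply: (tail_bounded iidX kn L0).
  - exact: summableD s1 s2.
  - by rewrite (PexpD s1 s2) Pexp_cst subrr.
  - by rewrite mulr_gt0 // exprn_gt0.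
  - by move=> t; apply: le_trans (ler_normB _ _) _; have := b1 t; lra.
apply: fails_wp_le_weaken (fails_wp_le_forall ev).
  by rewrite card_prod !card_ord natrM.
move=> w /= hw i j jS; have := hw (i, enum_rank_in jS j).
by rewrite /= enum_rankK_in // emp_meanD emp_mean_cst.
Qed.

Lemma gram_rate k L : (0 < k)%N -> 0 <= L -> 75 * xi ^+ 2 * L <= k%:R ->
  2 * U ^+ 2 * Num.sqrt (2 * L / k%:R) <= 1 / 3 * gam / ell.
Proof.
move=> k0 L0 hk.
have k1 : 0 < k%:R :> R by rewrite ltr0n.
have r := sqrt_rate_le (le_trans ler01 xi1) L0 k1 hk.
rewrite U2E (_ : _ * Num.sqrt _ = 2 * (Num.sqrt (2 * L / k%:R) * xi) * (gam / ell)); last by ring.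
rewrite -[leRHS]mulrA ler_wpM2r ?divr_ge0 ?(ltW gam0) ?(ltW ell0) //.
lra.
Qed.

Lemma support_whp (delta lam : R) (N : nat) : 0 < delta < 1 -> (1 <= N <= n)%N ->
  (forall j k, j \notin S -> k \in S -> G j k = 0) ->
  75 * xi ^+ 2 * ln (20 * ell * m%:R / delta) <= N%:R ->
  13 * U * Num.sqrt (ln (20 * m%:R / delta)) * (tau / Num.sqrt N%:R) <= lam ->
  (forall k, k \in S -> lam <= gam / (3 * Num.sqrt ell) * `|bs k|) ->
  fails_wp_le Q (2 / 5 * delta) (fun w => forall b,
    is_lasso N f h lam (X ^~ w) b -> supp b = S).
Proof.
move=> /andP[d0 d1] Nn G0 hN lam1 lam2.
set L := ln _ in hN; set l := ln _ in lam1.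
have m1 : 1 <= m%:R :> R := le_trans ell1 ellm.
have m0 : 0 < m%:R :> R := lt_le_trans ltr01 m1.
have a1 : 1 < 20 * m%:R / delta by rewrite ltr_pdivlMr //; lra.
have a2 : 20 * m%:R / delta <= 20 * ell * m%:R / delta.
  by rewrite ler_pM2r ?invr_gt0 // ler_wpM2r ?(ltW m0) // ler_peMr.
have a0 : 0 < 20 * m%:R / delta := lt_trans ltr01 a1.
have l0 : 0 < l by rewrite /l ln_gt0.
have lL : l <= L by rewrite /l /L ler_ln ?posrE // (lt_le_trans a0).
have L0 : 0 <= L := le_trans (ltW l0) lL.
have eL : expR (- L) = delta / (20 * ell * m%:R).
  by rewrite /L expRN_ln ?invf_div // (lt_le_trans a0).
have el : expR (- l) = delta / (20 * m%:R) by rewrite /l expRN_ln // invf_div.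
have N0 : 0 < N%:R :> R by rewrite ltr0n; case/andP: Nn.
set rho := Num.sqrt (2 * L / N%:R); set sig := Num.sqrt (2 * l / N%:R).
(* [E1] to [E4] each fail with probability at most [delta / 10]. *)
have E1 := gram_whp Nn L0.
have E2 := fails_wp_le_forall (fun j => tail_bounded iidX Nn L0
  (summable_h P mh hbd j) (h0 j) U0 (fun t => le_Uh hbd j t)).
have E3 := fails_wp_le_forall (fun j => tail_noise_mul1 iidX Nn (ltW l0) meps sg tau0 U0
  (fun t => le_Uh hbd j t) (summable_noise_h bs f2 mh hbd j)
  (noise_orthogonal f2 mh hbd bs_min j)).
have E4 := tail_noise iidX Nn (ltW l0) meps sg tau0.
apply: fails_wp_le_weaken (fails_wp_le_and E1 (fails_wp_le_and E2 (fails_wp_le_and E3 E4))).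
  rewrite !card_ord eL el.
  have -> : m%:R * ell * (2 * (delta / (20 * ell * m%:R))) +
    (m%:R * (2 * (delta / (20 * ell * m%:R))) +
     (m%:R * (2 * (delta / (20 * m%:R))) + 2 * (delta / (20 * m%:R))))
     = delta / 10 * (2 + ell^-1 + m%:R^-1) by field; rewrite !gt_eqF.
  have i1 : ell^-1 <= 1 by rewrite invf_le1.
  have i2 : m%:R^-1 <= 1 :> R by rewrite invf_le1.
  have := ler_wpM2l (ltW d0) i1; have := ler_wpM2l (ltW d0) i2; lra.
move=> w [H1 [H2 [H3 H4]]] b bmin.
set x := X ^~ w in H1 H2 H3 H4 bmin.
have rho0 : 0 <= rho := sqrtr_ge0 _.
have sig0 : 0 <= sig := sqrtr_ge0 _.
have rx : rho * xi <= 1 / 6.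
  exact: sqrt_rate_le (le_trans ler01 xi1) L0 N0 hN.
have r1 : rho <= 1 / 6 by apply: le_trans rx; rewrite ler_peMr.
(* [sig] carries an extra [sqrt 2], and [91 / 10 * sqrt 2 <= 13]. *)
have lamE : 91 / 10 * U * tau * sig <= lam.
  have -> : sig = Num.sqrt 2 * (Num.sqrt l * (Num.sqrt N%:R)^-1).
    by rewrite /sig -mulrA sqrtrM // sqrtrM ?(ltW l0) // sqrtrV ?(ltW N0).
  apply: le_trans lam1.
  have s2 : Num.sqrt 2 <= 71 / 50 :> R.
    rewrite -(ler_pXn2r (n := 2)) ?nnegrE ?sqrtr_ge0 ?sqr_sqrtr //; lra.
  have y0 : 0 <= U * tau * (Num.sqrt l * (Num.sqrt N%:R)^-1).
    by rewrite !mulr_ge0 ?invr_ge0 ?sqrtr_ge0 // ltW.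
  have -> : 91 / 10 * U * tau * (Num.sqrt 2 * (Num.sqrt l * (Num.sqrt N%:R)^-1))
    = (91 / 10 * Num.sqrt 2) * (U * tau * (Num.sqrt l * (Num.sqrt N%:R)^-1)) by ring.
  have -> : 13 * U * Num.sqrt l * (tau / Num.sqrt N%:R) =
    13 * (U * tau * (Num.sqrt l * (Num.sqrt N%:R)^-1)) by ring.
  by rewrite ler_wpM2r //; lra.
have lamp : 0 < lam.
  apply: lt_le_trans lam1; rewrite !mulr_gt0 ?invr_gt0 ?sqrtr_gt0 //.
pose b1 j := b j - bs j.
have bE : b = fun j => bs j + b1 j by apply/funext => j; rewrite /b1; ring.
rewrite bE.
have cov_sym j k : emp_cov x N (h j) (h k) = emp_cov x N (h k) (h j).
  rewrite /emp_cov [in RHS]mulrC; congr (_ - _).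
  by apply: eq_emp_mean => t; rewrite mulrC.
(* [kap = 37 / 100] covers [1 / 3] from the second moments plus [1 / 36] from the product of means.
   [wb = 24 / 100] covers [(2 + 1 / 6) / (91 / 10)]: 2 from the mean of [eps h], [1 / 6] from the
   product of means. Then [incoh] reads [0.61 < 0.63]. *)
apply: (@lasso_support R m (fun j k => emp_cov x N (h j) (h k))
  (fun j => emp_cov x N eps (h j)) bs lam cov_sym
  (fun c => emp_cov_psd h x c Nn) gam (37 / 100) (24 / 100) G) => //.
- move=> c c0; exact (Gram_coercive_fun P h S0 c0).
- move=> j k kS; rewrite /emp_cov.
  have hj := H2 j; have hk := H2 k; have hjk := H1 j k kS.
  have rate := gram_rate (proj1 (andP Nn)) L0 hN.
  have hh : `|emp_mean N (h j) x * emp_mean N (h k) x| <= 1 / 36 * gam / ell.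
    rewrite normrM; apply: le_trans (ler_pM _ _ hj hk) _ => //; rewrite -/rho.
    have -> : U * rho * (U * rho) = (2 * U ^+ 2) * rho ^+ 2 / 2 by field.
    rewrite U2E (_ : _ / 2 = (rho * xi) * rho * (gam / ell)); last by field; rewrite gt_eqF.
    rewrite -[leRHS]mulrA ler_wpM2r ?divr_ge0 ?(ltW gam0) ?(ltW ell0) //.
    have := ler_pM (mulr_ge0 rho0 (le_trans ler01 xi1)) rho0 rx r1; lra.
  rewrite addrAC; apply: le_trans (ler_normB _ _) _.
  have -> : 37 / 100 * gam / ell = 37 / 100 * (gam / ell) by rewrite mulrA.
  have := le_trans hjk rate; have : 0 <= gam / ell by rewrite divr_ge0 ?(ltW gam0) ?(ltW ell0).
  by move: hh; rewrite -!mulrA; lra.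
- move=> j; rewrite /emp_cov; apply: le_trans (ler_normB _ _) _.
  have h3 := H3 j; have h2 := H2 j; rewrite (normrM (emp_mean N eps x)).
  have hp := ler_pM (normr_ge0 _) (normr_ge0 _) H4 h2.
  have y0 : 0 <= U * tau * sig by rewrite !mulr_ge0 // ltW.
  have hr := ler_wpM2l y0 r1.
  apply: le_trans (lerD h3 hp) _; rewrite -/sig -/rho; lra.
- lra.
- lra.
- move=> k kS; have hk := lam2 k kS; rewrite -/ell.
  have sl : 0 < Num.sqrt ell by rewrite sqrtr_gt0.
  have bk : 0 < `|bs k| by rewrite normr_gt0; move: kS; rewrite inE.
  have : lam * Num.sqrt ell <= gam * `|bs k| / 3.
    apply: le_trans (ler_wpM2r (ltW sl) hk) _.
    by rewrite le_eqVlt; apply/orP; left; apply/eqP; field; rewrite gt_eqF.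
  have := mulr_gt0 gam0 bk; lra.
- move=> D; have := bmin (fun j => bs j + D j).
  by rewrite bE !(lasso_objE _ fE) // lerD2l.
Qed.

Lemma lslasso_whp (delta : R) (N : nat) : 0 < delta < 1 -> (1 <= N <= n)%N ->
  75 * xi ^+ 2 * ln (20 * ell * m%:R / delta) <= N%:R ->
  fails_wp_le Q (3 / 5 * delta) (fun w => forall alpha beta,
    is_lslasso f h (X ^~ w) S alpha beta ->
    `|alpha - Pexp P f| <= Num.sqrt (2 * ln (16 / delta)) * (tau / Num.sqrt n%:R)
      + 58 * Num.sqrt (B * ell * ln (16 * ell / delta) * ln (8 / delta)) * (tau / n%:R)).
Proof.
move=> /andP[d0 d1] Nn hN.
set L := ln _ in hN; set L1 := ln (16 * ell / delta); set L2 := ln (8 / delta).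
set L3 := ln (16 / delta).
have n1 : (0 < n)%N by case/andP: Nn => /leq_trans; apply.
have nn : (0 < n <= n)%N by rewrite n1 leqnn.
have n0 : 0 < n%:R :> R by rewrite ltr0n.
have m1 : 1 <= m%:R :> R := le_trans ell1 ellm.
have B0 : 0 < B := lt_le_trans ell0 ellB.
have p16 : 0 < 16 * ell / delta by rewrite divr_gt0 // mulr_gt0.
have m0 : 0 < m%:R :> R := lt_le_trans ltr01 m1.
have p20 : 0 < 20 * ell * m%:R / delta by rewrite divr_gt0 // !mulr_gt0.
have L1L : L1 <= L.
  rewrite /L1 /L ler_ln ?posrE //; apply: ler_wpM2r; first by rewrite invr_ge0 ltW.
  have : ell <= ell * m%:R by rewrite ler_peMr // ltW.
  by move: ell0; lra.
have L20 : 0 < L2 by rewrite /L2 ln_gt0 // ltr_pdivlMr //; lra.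
have L30 : 0 <= L3 by rewrite /L3 ln_ge0 // ler_pdivlMr //; lra.
have L31 : L3 <= L1.
  rewrite /L3 /L1 ler_ln ?posrE ?divr_gt0 ?mulr_gt0 //; apply: ler_wpM2r.
    by rewrite invr_ge0 ltW.
  by rewrite ler_peMr.
have L10 : 0 <= L1 := le_trans L30 L31.
have L0 : 0 <= L := le_trans L10 L1L.
(* [16 / delta <= (8 / delta) ^ 2] as [delta < 1]; this lets the mean of the noise be charged to the
   [ln (8 / delta)] of the second-order term. *)
have L32 : L3 <= 2 * L2.
  rewrite (_ : 2 * L2 = ln (8 / delta * (8 / delta))).
    rewrite /L3 ler_ln ?posrE ?divr_gt0 ?mulr_gt0 ?invr_gt0 //.
    by rewrite mulrA ler_pM2r ?invr_gt0 // mulrAC ler_pdivlMr //; lra.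
  by rewrite lnM ?posrE ?divr_gt0 // /L2; ring.
have hn : 75 * xi ^+ 2 * L <= n%:R.
  by apply: le_trans hN _; rewrite ler_nat; case/andP: Nn.
have xx : xi <= xi ^+ 2 by rewrite expr2 ler_peMr // (le_trans ler01).
have hn1 : 75 * (xi * L1) <= n%:R.
  apply: le_trans hn; rewrite -mulrA ler_pM2l //.
  by apply: ler_pM => //; exact: le_trans ler01 xi1.
have pG := psd_Gram P mh hbd S; have uG := Gram_unit mh hbd free.
have pI := psd_invmx pG uG.
set A := invmx (Gram P h S) in pI.
have hSB t : nrm A (hS h S t) <= Num.sqrt B.
  by apply: ler_wsqrtr; exact (ip_hS_le_Bstar mh hbd free S0 t).
have sB0 : 0 < Num.sqrt B by rewrite sqrtr_gt0.
have cZ : centered P (hS h S).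
  move=> i; rewrite (_ : (fun t => hS h S t 0 i) = h (enum_val i)).
    by split; [exact: summable_h|exact: h0].
  by apply/funext => t; rewrite mxE.
have ceZ : centered P (fun t => eps t *: hS h S t).
  move=> i; rewrite (_ : (fun t => (eps t *: hS h S t) 0 i) = fun t => eps t * h (enum_val i) t).
    by split; [exact: summable_noise_h|exact: noise_orthogonal].
  by apply/funext => t; rewrite !mxE.
(* [E1] to [E4] fail with probability at most [delta / 10], [delta / 8], [delta / 4] and
   [delta / 8]. *)
have E1 := gram_whp nn L0.
have E2 : fails_wp_le Q (2 * expR (- L1)) (fun w =>
    nrm A (\row_j emp_mean n (fun t => hS h S t 0 j) (X ^~ w)) <= 3 * Num.sqrt (ell * L1 / n%:R)).
  apply: (tail_bernstein iidX nn L10 pI cZ hSB ell0).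
  - exact: summable_ip_hS.
  - by rewrite (Pexp_ip_hS mh hbd free).
  - rewrite sqr_sqrtr ?(ltW B0) //.
    apply: (@le_trans _ _ n%:R); last by rewrite ler_peMr // ltW.
    apply: le_trans hn1; rewrite -mulrA.
    have : B * L1 <= xi * L1 by rewrite ler_wpM2r.
    have : 0 <= B * L1 by rewrite mulr_ge0 // ltW.
    by lra.
have E3 := tail_noise_mul iidX nn (ltW L20) meps sg tau0 pI sB0 hSB ceZ.
have E4 := tail_noise iidX nn L30 meps sg tau0.
apply: fails_wp_le_weaken (fails_wp_le_and E1 (fails_wp_le_and E2 (fails_wp_le_and E3 E4))).
  rewrite !expRN_ln ?divr_gt0 ?mulr_gt0 ?(lt_le_trans ltr01 m1) // !invf_div.
  have -> : m%:R * ell * (2 * (delta / (20 * ell * m%:R))) +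
     (2 * (delta / (16 * ell)) + (2 * (delta / 8) + 2 * (delta / 16)))
     = delta * (19 / 40 + ell^-1 / 8).
    by field; rewrite !gt_eqF ?(lt_le_trans ltr01 m1).
  have i1 : ell^-1 <= 1 by rewrite invf_le1.
  have := ler_wpM2l (ltW d0) i1; lra.
move=> w [H1 [H2 [H3 H4]]] alpha beta ols.
set x := X ^~ w in H1 H2 H3 H4 ols.
pose b j := beta j - bs j.
have bsS j : j \notin S -> bs j = 0 by rewrite inE negbK => /eqP.
have bS j : j \notin S -> b j = 0.
  by move=> jS; rewrite /b bsS // (ols.1 _ jS) subrr.
pose u : 'rV[R]_#|S| := \row_i b (enum_val i).
set eta := 3 * Num.sqrt (ell * L1 / n%:R) in H2.
set om := 2 * Num.sqrt B * tau * Num.sqrt (2 * L2 / n%:R) in H3.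
set e := tau * Num.sqrt (2 * L3 / n%:R) in H4.
have eta0 : 0 <= eta by rewrite mulr_ge0 ?sqrtr_ge0.
have om0 : 0 <= om by rewrite !mulr_ge0 ?sqrtr_ge0 // ltW.
have e0 : 0 <= e by rewrite mulr_ge0 ?sqrtr_ge0 // ltW.
(* [9 / 75 = 12 / 100], using [ell <= xi]. With [kap = 37 / 100] the denominator is then at least
   [51 / 100]. *)
have eta2 : eta ^+ 2 <= 12 / 100.
  rewrite exprMn sqr_sqrtr ?divr_ge0 ?mulr_ge0 ?(ltW n0) ?(ltW ell0) //.
  rewrite mulrA ler_pdivrMr //.
  have : ell * L1 <= xi * L1 by rewrite ler_wpM2r // (le_trans ellB).
  by lra.
have den : 1 / 2 <= 1 - 37 / 100 - eta ^+ 2 by lra.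
have den0 : 0 < 1 - 37 / 100 - eta ^+ 2 by lra.
have us : nrm (Gram P h S) u ^+ 2 = \sum_j \sum_k G j k * (b j * b k).
  by rewrite nrm_sqr // (Gram_fun P h bS).
have bound := ols_bound fE bsS n1 ols (nrm_ge0 (Gram P h S) u) eta0 _ _ _ H4 den0 om0.
apply: le_trans (bound _ _ _) _.
- rewrite us; apply: (form_perturbation ell0 gam0 _ bS) => //.
    exact (Gram_coercive_fun P h S0 bS).
  move=> j k kS; apply: le_trans (H1 j k kS) _.
  apply: le_trans (gram_rate n1 L0 hn) _.
  have := mulr_gt0 gam0 (_ : 0 < ell^-1); rewrite invr_gt0 => /(_ ell0).
  by rewrite -/ell -!mulrA; lra.
- rewrite (sum_enum_val (S := S)) => [|j /bS]; last by rewrite /b => ->; rewrite mulr0.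
  have := dual_CauchySchwarz pG uG u (\row_j emp_mean n (fun t => hS h S t 0 j) x).
  move=> cs; apply: le_trans (le_trans cs (ler_wpM2r (nrm_ge0 _ _) H2)).
  rewrite le_eqVlt; apply/orP; left; apply/eqP; congr `|_|; apply: eq_bigr => i _.
  rewrite !mxE mulrC; congr (_ * _); apply: eq_emp_mean => t; by rewrite mxE.
- rewrite (sum_enum_val (S := S)) => [|j /bS]; last by rewrite /b => ->; rewrite mulr0.
  have := dual_CauchySchwarz pG uG u (\row_j emp_mean n (fun t => eps t * hS h S t 0 j) x).
  move=> cs; apply: le_trans (le_trans cs (ler_wpM2r (nrm_ge0 _ _) H3)).
  rewrite le_eqVlt; apply/orP; left; apply/eqP; congr `|_|; apply: eq_bigr => i _.
  rewrite !mxE mulrC; congr (_ * _); apply: eq_emp_mean => t; by rewrite mxE.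
apply: lerD.
  rewrite le_eqVlt; apply/orP; left; apply/eqP; rewrite /e sqrtrM ?mulr_ge0 //.
  by rewrite sqrtrV ?(ltW n0) //; ring.
set D := Num.sqrt (B * ell * L1 * L2) * (tau / n%:R).
have D0 : 0 <= D by rewrite mulr_ge0 ?sqrtr_ge0 // divr_ge0 ?(ltW tau0) ?(ltW n0).
have D2 : D ^+ 2 = B * ell * L1 * L2 * tau ^+ 2 / n%:R ^+ 2.
  rewrite /D exprMn sqr_sqrtr ?mulr_ge0 ?(ltW B0) ?(ltW ell0) ?(ltW L20) //.
  by field; rewrite gt_eqF.
have eo0 : 0 <= eta * om := mulr_ge0 eta0 om0.
have ee0 : 0 <= e * eta := mulr_ge0 e0 eta0.
have D9 : 0 <= 9 * D by lra.
have D6 : 0 <= 6 * D by lra.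
(* The squares compare as [72 <= 81]. *)
have eo : eta * om <= 9 * D.
  rewrite -(ler_pXn2r (n := 2)) ?nnegrE // [leRHS]exprMn D2 /eta /om !exprMn.
  rewrite !sqr_sqrtr ?divr_ge0 ?mulr_ge0 ?(ltW n0) ?(ltW ell0) ?(ltW B0) ?(ltW L20) //.
  have -> : 3 ^+ 2 * (ell * L1 / n%:R) * (2 ^+ 2 * B * tau ^+ 2 * (2 * L2 / n%:R))
    = 72 * (B * ell * L1 * L2 * tau ^+ 2 / n%:R ^+ 2) by field; rewrite gt_eqF.
  by rewrite -D2; have := sqr_ge0 D; lra.
have ee : e * eta <= 6 * D.
  rewrite -(ler_pXn2r (n := 2)) ?nnegrE // [leRHS]exprMn D2 /e /eta !exprMn.
  rewrite !sqr_sqrtr ?divr_ge0 ?mulr_ge0 ?(ltW n0) ?(ltW ell0) //.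
  have -> : tau ^+ 2 * (2 * L3 / n%:R) * (3 ^+ 2 * (ell * L1 / n%:R))
    = 18 * L3 * (ell * L1 * tau ^+ 2 / n%:R ^+ 2) by field; rewrite gt_eqF.
  have -> : 6 ^+ 2 * (B * ell * L1 * L2 * tau ^+ 2 / n%:R ^+ 2)
    = (36 * (B * L2)) * (ell * L1 * tau ^+ 2 / n%:R ^+ 2) by ring.
  apply: ler_wpM2r.
    apply: divr_ge0; last exact: sqr_ge0.
    by apply: mulr_ge0; [exact: mulr_ge0 (ltW ell0) L10|exact: sqr_ge0].
  have : L2 <= B * L2 by rewrite ler_peMl ?(ltW L20) // (le_trans ell1).
  by lra.
have eta1 : eta <= 1.
  by rewrite -(expr_le1 (n := 2)) //; lra.
have ee1 : eta * (e * eta) <= 6 * D.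
  by apply: le_trans ee; rewrite ler_piMl // mulr_ge0.
rewrite (_ : 58 * _ * _ = 58 * D); last by rewrite /D mulrA.
(* The numerator is at most [9 D + 6 D], while the denominator is at least [1 / 2]; so 58 only has
   to exceed 30. *)
rewrite ler_pdivrMr // mulrDr.
have : 58 * D * (1 / 2) <= 58 * D * (1 - 37 / 100 - eta ^+ 2).
  by rewrite ler_wpM2l // mulr_ge0.
by lra.
Qed.

End Lslasso.

(** * Combination of support recovery with the least squares bound *)

Unset Implicit Arguments.

Theorem theorem4 (R : realType) (d : measure_display) (T : measurableType d)
  (P : probability T R) (m : nat) (f : T -> R) (h : 'I_m -> T -> R)
  (beta_star : 'I_m -> R) (tau : R)
  (dO : measure_display) (Omega : measurableType dO) (Q : probability Omega R)
  (n : nat) (X : 'I_n -> Omega -> T) :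
  in_L2 P f ->
  (forall j, in_L2 P (h j)) ->
  (forall j, (\int[P]_x (h j x)%:E = 0)%E) ->
  (forall beta : 'I_m -> R, (cv_risk P f h beta_star <= cv_risk P f h beta)%E) ->
  let eps := fun x => f x - Pexp P f - lincomb beta_star h x in
  let S := supp beta_star in
  S != finset.set0 ->
  (* (i) *)
  0 < tau -> subgaussian P eps tau ->
  (* (ii) *)
  (exists M : R, forall j x, `|h j x| <= M) ->
  (* (iii) linear independence of (h_k)_{k in S} in L_2(P) *)
  (forall c : 'I_m -> R, (forall j, j \notin S -> c j = 0) ->
     {ae P, forall x, lincomb c h x = 0} -> forall j, c j = 0) ->
  (* (iv) *)
  (forall j k, j \notin S -> k \in S -> Pexp P (fun x => h j x * h k x) = 0) ->
  let ell := #|S| in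
  let U := Uh h in
  let gamma := lambda_min (Gram P h S) in
  let xi := ell%:R * U ^+ 2 / gamma in
  let B := Bstar P h S in
  iid_sample Q P X ->
  forall (delta : R) (N : nat) (lam : R),
  0 < delta < 1 ->
  (1 <= N <= n)%N ->
  75 * xi ^+ 2 * ln (20 * ell%:R * m%:R / delta) <= N%:R ->
  13 * U * Num.sqrt (ln (20 * m%:R / delta)) * (tau / Num.sqrt N%:R) <= lam ->
  lam <= gamma / (3 * Num.sqrt ell%:R) * inf [set `|beta_star k| | k in [set k | k \in S]] ->
  forall (betaL : Omega -> 'I_m -> R) (alphaLS : Omega -> R) (betaLS : Omega -> 'I_m -> R),
  (forall w, is_lasso N f h lam (fun i => X i w) (betaL w)) ->
  (forall w, is_lslasso f h (fun i => X i w) (supp (betaL w)) (alphaLS w) (betaLS w)) ->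
  exists E : set Omega, measurable E /\ ((1 - delta)%:E <= Q E)%E /\
    forall w, E w ->
      `|alphaLS w - Pexp P f| <=
        Num.sqrt (2 * ln (16 / delta)) * (tau / Num.sqrt n%:R)
        + 58 * Num.sqrt (B * ell%:R * ln (16 * ell%:R / delta) * ln (8 / delta)) * (tau / n%:R).
Proof.
move=> f2 h2 h0 bs_min eps S S0 tau0 sg hbd free G0 ell U gamma xi B iidX.
move=> delta N lam delta01 Nn hN lam1 lam2 betaL alphaLS betaLS lassoL lsL.
have mh j : measurable_fun setT (h j) by case: (h2 j).
have eh j : Pexp P (h j) = 0 by rewrite /Pexp h0.
have gamma0 : 0 < gamma := lambda_min_Gram_gt0 mh hbd free S0.
have lam2' k : k \in S -> lam <= gamma / (3 * Num.sqrt ell%:R) * `|beta_star k|.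
  move=> kS; apply: le_trans lam2 _; apply: ler_wpM2l.
    by rewrite divr_ge0 ?mulr_ge0 ?sqrtr_ge0 // ltW.
  by apply: ge_inf; [exists 0 => _ [j _ <-] | exists k].
have supp_ok := support_whp f2 mh eh bs_min S0 tau0 sg hbd free iidX delta01 Nn G0 hN lam1 lam2'.
have ls_ok := lslasso_whp f2 mh eh bs_min S0 tau0 sg hbd free iidX delta01 Nn hN.
have [bad mbad [bad_le ok]] := fails_wp_le_and supp_ok ls_ok.
exists (~` bad); split; first exact: measurableC.
split.
  rewrite probability_setC // EFinB leeB //.
  by apply: le_trans bad_le _; rewrite lee_fin; lra.
(* The least squares bound is stated for the fixed support [S]; on the good event the selected
   support equals it, whichever LASSO minimizer was chosen. *)
move=> w /ok[suppE]; apply.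
by rewrite -(suppE _ (lassoL w)); exact: lsL.
Qed.
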